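(* Let $K$ be a totally real number field with $[K:\mathbb{Q}]=3$, and let $F$ be a $2$-dimensional face of the sail $\mathcal{S}_K$. Then \[ \iota_{\mathrm{int}}(F)=(\mathrm{ID}(F)-1)\,\mathrm{IV}(F). \]
   Context: $\tau_1,\tau_2,\tau_3$ are the real embeddings of $K$, $\iota_M:K\to\mathbb{R}^3$, $\alpha\mapsto(\tau_1(\alpha),\tau_2(\alpha),\tau_3(\alpha))$, $\Lambda=\iota_M(\mathcal{O}_K)$. $\mathcal{O}_K^+$ is the set of totally positive elements of $\mathcal{O}_K$; $\alpha\in\mathcal{O}_K^+$ is indecomposable if it is not a sum of two elements of $\mathcal{O}_K^+$. The sail $\mathcal{S}_K$ is the boundary of $\operatorname{Conv}(\Lambda\cap\mathbb{R}_{>0}^3)$. The integer volume of an integer simplex $S=\langle v_0,\dots,v_d\rangle$ (vertices in $\Lambda$) is the index of the subgroup generated by $v_1-v_0,\dots,v_d-v_0$ in $\Lambda\cap\operatorname{Span}_{\mathbb{R}}(v_1-v_0,\dots,v_d-v_0)$; $\mathrm{IV}$ of an integer polytope is the sum over a decomposition into integer simplices of the same dimension. For an integer polytope $S$ whose affine hull $A$ does not contain $0$, $\mathrm{ID}(S)$ is the index of the subgroup generated by $A\cap\Lambda$ in $\Lambda\cap\operatorname{Span}_{\mathbb{R}}(A)$. $\iota_{\mathrm{int}}(F)$ is the number of indecomposable $\alpha\in\mathcal{O}_K^+$ with $\iota_M(\alpha)\in\{tx:t>0,x\in F\}\setminus F$. *)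

(* Defs.v *)
From HB Require Import structures.
From mathcomp Require Import all_boot all_order all_algebra all_field.
From mathcomp Require Import all_classical all_reals all_analysis.
From Stdlib Require Import ClassicalEpsilon.
Set Implicit Arguments. Unset Strict Implicit. Unset Printing Implicit Defensive.
Import Order.TTheory GRing.Theory Num.Theory.
Import numFieldNormedType.Exports.
Local Open Scope classical_set_scope.
Local Open Scope ring_scope.

Section Sail.
Variable R : realType.
Local Notation V := 'rV[R]_3.

Definition dotv (u x : V) : R := (u *m x^T) 0 0.

Definition conv (S : set V) : set V :=
  [set x | exists (n : nat) (p : 'I_n -> V) (w : 'I_n -> R),
     (forall i, S (p i)) /\ (forall i, 0 <= w i) /\ \sum_i w i = 1 /\
     x = \sum_i w i *: p i].
Definition aff_hull (S : set V) : set V :=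
  [set x | exists (n : nat) (p : 'I_n -> V) (w : 'I_n -> R),
     (forall i, S (p i)) /\ \sum_i w i = 1 /\ x = \sum_i w i *: p i].
Definition rspan (S : set V) : set V :=
  [set x | exists (n : nat) (p : 'I_n -> V) (w : 'I_n -> R),
     (forall i, S (p i)) /\ x = \sum_i w i *: p i].
Definition zspan (S : set V) : set V :=
  [set x | exists (n : nat) (p : 'I_n -> V) (w : 'I_n -> int),
     (forall i, S (p i)) /\ x = \sum_i p i *~ w i].

Definition boundary (S : set V) : set V := closure S `\` interior S.

Definition is_index (G H : set V) (n : nat) : Prop :=
  exists s : seq V, size s = n /\ (forall x, x \in s -> G x) /\
    (forall i j, (i < n)%N -> (j < n)%N -> i != j ->
        ~ H (nth 0 s i - nth 0 s j)) /\
    (forall g, G g -> exists i, (i < n)%N /\ H (g - nth 0 s i)).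
(** the index [G : H] (only meaningful when finite) *)
Definition lat_index (G H : set V) : nat :=
  epsilon (inhabits 0%N) (is_index G H).

Variable K : fieldExtType rat.

Definition integralZ (a : K) : Prop :=
  exists p : {poly int}, p \is monic /\
    root (map_poly (fun z : int => z%:~R : K) p) a.

Variable tau : 'I_3 -> {rmorphism K -> R}.

Definition iotaM (a : K) : V := \row_i tau i a.
Definition Lambda : set V := [set v | exists a, integralZ a /\ v = iotaM a].

Definition totpos (a : K) : Prop := integralZ a /\ forall i, 0 < tau i a.
Definition indecomposable (a : K) : Prop :=
  totpos a /\ ~ (exists b c, totpos b /\ totpos c /\ a = b + c).

Definition posorth : set V := [set v | forall i, 0 < v 0 i].
Definition sailhull : set V := conv (Lambda `&` posorth).
Definition sail : set V := boundary sailhull.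

Definition is_2face (F : set V) : Prop :=
  exists (u : V) (c : R), u != 0 /\
    (forall x, sailhull x -> c <= dotv u x) /\
    F = sail `&` [set x | dotv u x = c] /\
    exists p0 p1 p2, F p0 /\ F p1 /\ F p2 /\
      \rank (col_mx (p1 - p0) (p2 - p0)) = 2%N.

Definition tri (t : V * V * V) : set V :=
  let: (a, b, c) := t in conv [set x | x = a \/ x = b \/ x = c].
Definition tri_relint (t : V * V * V) : set V :=
  let: (a, b, c) := t in
  [set x | exists wa wb wc : R, 0 < wa /\ 0 < wb /\ 0 < wc /\
       wa + wb + wc = 1 /\ x = wa *: a + wb *: b + wc *: c].
Definition int_tri (t : V * V * V) : Prop :=
  let: (a, b, c) := t in Lambda a /\ Lambda b /\ Lambda c /\
    \rank (col_mx (b - a) (c - a)) = 2%N.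
Definition IV_tri (t : V * V * V) : nat :=
  let: (a, b, c) := t in
  let E := [set x | x = b - a \/ x = c - a] in
  lat_index (Lambda `&` rspan E) (zspan E).

Definition int_decomposition (F : set V) (D : seq (V * V * V)) : Prop :=
  (forall t, t \in D -> int_tri t) /\
  (forall x, F x <-> exists2 t, t \in D & tri t x) /\
  (forall i j, (i < size D)%N -> (j < size D)%N -> i != j ->
     tri_relint (nth (0, 0, 0) D i) `&` tri_relint (nth (0, 0, 0) D j) = set0).
Definition IV_decomp (D : seq (V * V * V)) : nat := (\sum_(t <- D) IV_tri t)%N.

Definition ID (S : set V) : nat :=
  lat_index (Lambda `&` rspan (aff_hull S)) (zspan (aff_hull S `&` Lambda)).

Definition iint_set (F : set V) (a : K) : Prop :=
  indecomposable a /\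
  (exists (t : R) (x : V), 0 < t /\ F x /\ iotaM a = t *: x) /\
  ~ F (iotaM a).

End Sail.

Definition has_card (T : eqType) (P : T -> Prop) (n : nat) : Prop :=
  exists s : seq T, uniq s /\ size s = n /\ forall a, a \in s <-> P a.

(* Main.v *)
Require Import Defs.
From HB Require Import structures.
From mathcomp Require Import all_boot all_order all_algebra all_field.
From mathcomp Require Import all_classical all_reals all_analysis.
From mathcomp Require Import ring lra zify.
Set Implicit Arguments. Unset Strict Implicit. Unset Printing Implicit Defensive.
Import Order.TTheory GRing.Theory Num.Theory.
Import numFieldNormedType.Exports.
Local Open Scope classical_set_scope.
Local Open Scope ring_scope.

(** Write [h] for the linear form [u] divided by [c], so that [h = 1] on the plane of the face.
    The norm form keeps the hull inside [x y z >= 1], and lattice points with two small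
    coordinates (Dirichlet) force [u] to be positive; hence every slab contains finitely many
    totally positive lattice points, and the face is the convex hull of the finitely many
    totally positive lattice points of height [1].  All other ones have height [> 1].

    Take an integer triangle [abd] of a decomposition.  A lattice point of the half-open
    parallelepiped on [a, b, d] of non-integral height has height in [(1, 2)]: height below [1]
    is impossible, and reflecting through the centre of the parallelepiped (or of a facet)
    excludes heights above [2] (or points on the boundary of the cone).  Such points are
    indecomposable, since a sum of two totally positive elements has height at least [2].
    Conversely an indecomposable of the cone outside the face lies in the parallelepiped, and
    its height is not [2] by a descent on the area of the triangle.  The parallelepiped contains
    [IV] lattice points for each class of lattice points modulo those of integral height, and
    there are [ID - 1] nonzero classes.

    For the existence of a decomposition, an irredundant set of at least four vertices is split
    along the line through two of them that strictly separates two others. *)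

(** * Arithmetic of the lattice *)

Lemma ord3P (P : 'I_3 -> Prop) : P 0 -> P 1 -> P 2%:R -> forall i, P i.
Proof.
move=> p0 p1 p2 [[|[|[|//]]] h].
- by rewrite (_ : Ordinal h = 0); last exact: val_inj.
- by rewrite (_ : Ordinal h = 1); last exact: val_inj.
- by rewrite (_ : Ordinal h = 2%:R); last exact: val_inj.
Qed.

Lemma sum3 (U : nmodType) (f : 'I_3 -> U) : \sum_i f i = f 0 + f 1 + f 2%:R.
Proof.
rewrite !big_ord_recl big_ord0 addr0 addrA; congr (f _ + f _ + f _); exact: val_inj.
Qed.

Section Arithmetic.
Variables (R : realType) (K : fieldExtType rat).

Lemma integralZP (a : K) : integralZ a <-> integralOver (intr : int -> K) a.
Proof. by split=> [[p [pm pr]]|[p pm pr]]; exists p. Qed.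

Lemma integralZ_sub (a b : K) : integralZ a -> integralZ b -> integralZ (a - b).
Proof. by move=> /integralZP ? /integralZP ?; apply/integralZP/integral_sub. Qed.

Lemma integralZ_add (a b : K) : integralZ a -> integralZ b -> integralZ (a + b).
Proof. by move=> /integralZP ? /integralZP ?; apply/integralZP/integral_add. Qed.

Lemma integralZ_mul (a b : K) : integralZ a -> integralZ b -> integralZ (a * b).
Proof. by move=> /integralZP ? /integralZP ?; apply/integralZP/integral_mul. Qed.

(** Embedded in [algC], [q] becomes a rational algebraic integer, and those are known to be
    integers. *)
Lemma integral_rat_int (q : rat) : integralOver (intr : int -> rat) q -> q \is a Num.int.
Proof.
case=> p pm pr.
have qA : (ratr q : algC) \in Aint.
  apply: (@root_monic_Aint (map_poly intr p)).
  - have : root (map_poly ratr (map_poly intr p)) (ratr q : algC) by rewrite fmorph_root.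
    rewrite -map_poly_comp; congr (root _ _); apply: eq_map_poly => z /=.
    by rewrite ratr_int.
  - by apply: monic_map.
  - by apply/polyOverP => i; rewrite coef_map /= intr_int.
have := Cint_rat_Aint (Crat_rat q) qA.
by move=> /intrP[m /eqP]; rewrite -(ratr_int algC) (inj_eq (fmorph_inj _)) => /eqP ->;
  exact: intr_int.
Qed.

Hypothesis hdeg : \dim {:K} = 3%N.
Variable tau : 'I_3 -> {rmorphism K -> R}.
Hypothesis htau : forall i j : 'I_3, i != j -> exists x : K, tau i x != tau j x.

(** The degree divides the prime 3 and is not 1. *)
Lemma adjoin_degree3 (a : K) : a \notin 1%VS -> adjoin_degree 1 a = 3%N.
Proof.
move=> an; have d1 : adjoin_degree 1%AS a != 1%N by rewrite adjoin_deg_eq1.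
have dE := dim_Fadjoin 1%AS a; rewrite dimv1 muln1 in dE.
have := field_dimS (subvf <<1%AS; a>>); rewrite dE hdeg.
by move/(prime_nt_dvdP (isT : prime 3) d1).
Qed.

Lemma tau_alg i (q : rat) : tau i q%:A = ratr q.
Proof. by rewrite alg_num_field fmorph_rat. Qed.

(** An element outside the rationals generates [K], the degree being prime, so two embeddings that
    agree on it agree everywhere. *)
Lemma tau_sep (a : K) i j : a \notin 1%VS -> i != j -> tau i a != tau j a.
Proof.
move=> an ij; apply/eqP => tE; have [x /eqP] := htau ij; apply.
have : x \in <<1%AS; a>>%VS.
  suff -> : <<1%AS; a>>%VS = fullv by rewrite memvf.
  by apply/eqP; rewrite eqEdim subvf dim_Fadjoin dimv1 muln1 adjoin_degree3 ?hdeg.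
case/Fadjoin_polyP=> p /polyOver1P[q ->] ->.
have tauE k : tau k (map_poly (in_alg K) q).[a] = (map_poly ratr q).[tau k a].
  rewrite -horner_map -map_poly_comp /=; congr (_.[_]); apply: eq_map_poly => r /=.
  exact: tau_alg.
by rewrite !tauE tE.
Qed.

(** Outside the rationals, the three conjugates are distinct and hence all the roots of the minimal
    polynomial; their product is minus its constant coefficient. *)
Lemma tau_norm_rat (a : K) : exists q : rat, tau 0 a * tau 1 a * tau (2%:R) a = ratr q.
Proof.
have [/vlineP[q ->]|an] := boolP (a \in 1%VS).
  by exists (q ^+ 3); rewrite !tau_alg !exprS expr0 mulr1 !rmorphM /= mulrA.
have /polyOver1P[p pE] := minPolyOver 1%AS a.
set pR := map_poly (ratr : rat -> R) p.
have rt i : root pR (tau i a).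
  have := root_minPoly 1%AS a; rewrite pE -(fmorph_root (tau i)) -map_poly_comp.
  by congr (root _ _); apply: eq_map_poly => r /=; exact: tau_alg.
have szp : size p = 4%N.
  by have := size_minPoly 1%AS a; rewrite pE size_map_poly adjoin_degree3.
have pm : p \is monic by have := monic_minPoly 1%AS a; rewrite pE map_monic.
have : pR = \prod_(z <- [:: tau 0 a; tau 1 a; tau (2%:R) a]) ('X - z%:P).
  rewrite [LHS](@all_roots_prod_XsubC _ _ [:: tau 0 a; tau 1 a; tau (2%:R) a]).
  - by rewrite lead_coef_map (monicP pm) rmorph1 scale1r.
  - by rewrite size_map_poly szp.
  - by rewrite /= !rt.
  - by rewrite uniq_rootsE /= !inE !negb_or !tau_sep.
rewrite !big_cons big_nil mulr1 => /(congr1 (fun s : {poly R} => s.[0])).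
rewrite !hornerM !hornerXsubC !sub0r horner_coef0 coef_map => e.
exists (- p`_0); rewrite rmorphN e; ring.
Qed.

(** The norm is rational and integral over the integers, so it is a nonzero integer. *)
Lemma tau_norm_ge1 (a : K) : integralZ a -> a != 0 ->
  1 <= `|tau 0 a * tau 1 a * tau (2%:R) a|.
Proof.
move=> /integralZP ai a0; have [q qE] := tau_norm_rat a.
have ti i : integralOver (intr : int -> R) (tau i a).
  have [p pm pr] := integral_rmorph (tau i) ai; exists p => //.
  by move: pr; congr (root _ _); apply: eq_map_poly => z /=; rewrite rmorph_int.
have qi : integralOver (intr : int -> R) (ratr q).
  by rewrite -qE; apply: integral_mul; first apply: integral_mul.
have /intrP[z zE] : q \is a Num.int.
  apply: integral_rat_int; case: qi => p pm pr; exists p => //.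
  move: pr; rewrite -(fmorph_root (ratr : {rmorphism rat -> R})) -map_poly_comp.
  by congr (root _ _); apply: eq_map_poly => z /=; rewrite ratr_int.
have z0 : z != 0.
  apply: contra_neq a0 => z0; move: qE; rewrite zE z0 rmorph0 => /eqP.
  by rewrite !mulf_eq0 !fmorph_eq0 -orbA => /or3P[] /eqP.
by rewrite qE zE ratr_int -intr_norm (ler_int _ 1); lia.
Qed.

Lemma iotaM_inj : injective (iotaM tau).
Proof. by move=> a b /rowP/(_ 0); rewrite !mxE => /fmorph_inj. Qed.

Lemma truncn_close (x y : R) : 0 <= x -> 0 <= y -> Num.truncn x = Num.truncn y ->
  `|x - y| < 1.
Proof.
move=> x0 y0 e; have := truncn_itv x0; have := truncn_itv y0;
  rewrite -e -natr1 => /andP[y1 y2] /andP[x1 x2].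
by rewrite ltr_norml; apply/andP; split; lra.
Qed.

(* Dirichlet's pigeonhole: [(k^2 + 1)^3] values in a square of side [O(k^2)], cut into
   [(k^3 + 1)^2] cells of side [O(1/k)]. *)
Lemma quadratic_simultaneous_approx (x y eps : R) : 0 < eps ->
  exists n : 'I_3 -> int, (exists i, n i != 0) /\
    forall z, z = x \/ z = y -> `|(n 0)%:~R + (n 1)%:~R * z + (n 2%:R)%:~R * z ^+ 2| < eps.
Proof.
move=> e0.
pose C : R := 1 + `|x| + x ^+ 2 + `|y| + y ^+ 2.
have Cx z : z = x \/ z = y -> 1 + `|z| + z ^+ 2 <= C.
  have := normr_ge0 x; have := normr_ge0 y; have := sqr_ge0 x; have := sqr_ge0 y.
  by rewrite /C; move=> ? ? ? ? [->|->]; lra.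
have C0 : 0 < C.
  have := normr_ge0 x; have := normr_ge0 y; have := sqr_ge0 x; have := sqr_ge0 y.
  by rewrite /C; lra.
(* [k] is chosen so large that the side [2 C / k] of a cell is below [eps]. *)
pose k := (Num.truncn (2 * C / eps)).+1.
have kC : 2 * C / k%:R < eps.
  have h : 2 * C / eps < k%:R by exact: truncnS_gt.
  by rewrite ltr_pdivrMr ?ltr0n // [eps * _]mulrC -ltr_pdivrMr.
have k0 : 0 < k%:R :> R by rewrite ltr0n.
pose N := (k ^ 2)%N; pose M := (k ^ 3)%N.
pose T := ('I_N.+1 * 'I_N.+1 * 'I_N.+1)%type.
pose v (z : R) (n : T) : R := n.1.1%:R + n.1.2%:R * z + n.2%:R * z ^+ 2.
(* An affine rescaling of the range [[-C N, C N]] of [v z] to [[0, M]], turning cells into unit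
   intervals. *)
pose g z n := (v z n + C * N%:R) * (k%:R / (2 * C)).
have vb z n : z = x \/ z = y -> `|v z n| <= C * N%:R.
  move=> hz; have := Cx _ hz; rewrite /v; case: n => [[a b] c] /= hC.
  have hN (i : 'I_N.+1) : (i%:R : R) <= N%:R by rewrite ler_nat -ltnS.
  apply: le_trans (_ : N%:R + N%:R * `|z| + N%:R * z ^+ 2 <= _); last first.
    by have : 0 <= N%:R :> R by []; nra.
  rewrite (le_trans (ler_normD _ _)) // lerD ?(le_trans (ler_normD _ _)) ?lerD //.
  - by rewrite ger0_norm.
  - by rewrite normrM ger0_norm // ler_wpM2r.
  - by rewrite normrM ger0_norm // ger0_norm ?sqr_ge0 // ler_wpM2r ?sqr_ge0.
have g0 z n : z = x \/ z = y -> 0 <= g z n.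
  move=> hz; have := vb z n hz; rewrite ler_norml => /andP[h _].
  by rewrite /g mulr_ge0 ?divr_ge0 ?mulr_ge0 ?(ltW k0) ?(ltW C0) //; lra.
have gM z n : z = x \/ z = y -> (Num.truncn (g z n) < M.+1)%N.
  move=> hz; rewrite truncn_lt_nat ?g0 //.
  apply: le_lt_trans (_ : M%:R < _); last by rewrite ltr_nat.
  have := vb z n hz; rewrite ler_norml => /andP[_ h].
  have -> : M%:R = (2 * C * N%:R) * (k%:R / (2 * C)) :> R.
    by rewrite /M /N !natrX; field; rewrite gt_eqF.
  by rewrite /g ler_wpM2r ?divr_ge0 ?mulr_ge0 ?(ltW k0) ?(ltW C0) //; lra.
pose f (n : T) : 'I_M.+1 * 'I_M.+1 := (inord (Num.truncn (g x n)), inord (Num.truncn (g y n))).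
(* Pigeonhole: [(k^3 + 1)^2 < (k^2 + 1)^3] for positive [k]. *)
have /injectivePn[n [m nm]] : ~~ injectiveb f.
  apply/negP => /injectiveP /leq_card; rewrite !card_prod !card_ord /M /N.
  by rewrite leqNgt => /negP; apply; have : (0 < k)%N by []; nia.
have tl z : z = x \/ z = y -> Num.truncn (g z n) = Num.truncn (g z m) -> `|v z n - v z m| < eps.
  move=> hz /(truncn_close (g0 _ _ hz) (g0 _ _ hz)).
  have -> : g z n - g z m = (v z n - v z m) * (k%:R / (2 * C)) by rewrite /g; ring.
  rewrite normrM [X in _ * X]ger0_norm ?divr_ge0 ?mulr_ge0 ?(ltW k0) ?(ltW C0) //.
  rewrite -ltr_pdivlMr ?divr_gt0 ?mulr_gt0 // mul1r invf_div => h.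
  exact: lt_trans h kC.
move=> /eqP; rewrite xpair_eqE => /andP[/eqP/(congr1 val) ex /eqP/(congr1 val) ey].
have hx : x = x \/ x = y by left.
have hy : y = x \/ y = y by right.
rewrite /= !(inordK (gM _ _ hx)) !(inordK (gM _ _ hy)) in ex ey.
pose d (i : 'I_3) : int := if i == 0 then n.1.1%:Z - m.1.1%:Z
  else if i == 1 then n.1.2%:Z - m.1.2%:Z else n.2%:Z - m.2%:Z.
exists d; split; last first.
  move=> z hz; have := tl z hz.
  have -> : (d 0)%:~R + (d 1)%:~R * z + (d 2%:R)%:~R * z ^+ 2 = v z n - v z m.
    by rewrite /d /v /= !rmorphB /=; ring.
  by apply; case: hz => [->|->].
apply: contrapT => nex; move/negP: nm; apply.
have d0 i : d i = 0 by apply/eqP/negPn/negP => h; apply: nex; exists i.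
have := d0 0; have := d0 1; have := d0 2%:R; rewrite /d /=.
case: (n) (m) => [[a b] c] [[a' b'] c'] /= /subr0_eq[e1] /subr0_eq[e2] /subr0_eq[e3].
by rewrite !xpair_eqE -!val_eqE /= e1 e2 e3 !eqxx.
Qed.

(** Clear denominators in the minimal polynomial of an irrational element; the leading coefficient
    times that element is integral and still irrational. *)
Lemma exists_integral_nonrational : exists a : K, integralZ a /\ a \notin 1%VS.
Proof.
have /subvPn[x _ xn] : ~~ ({:K} <= 1%VS)%VS.
  by apply/negP => /dimvS; rewrite hdeg dimv1.
have /polyOver1P[p pE] := minPolyOver 1%AS x.
have szp : size p = 4%N.
  by have := size_minPoly 1%AS x; rewrite pE size_map_poly adjoin_degree3.
have px : root (map_poly (in_alg K) p) x by rewrite -pE root_minPoly.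
have [q [m m0 qE]] := rat_poly_scale p.
have m0' : (m%:~R : rat) != 0 by rewrite intr_eq0.
have szq : size q = 4%N.
  have := szp; rewrite qE size_scale ?invr_eq0 //.
  by rewrite size_map_inj_poly // => a b /intr_inj.
have q3 : q`_3 != 0.
  have -> : q`_3 = lead_coef q by rewrite lead_coefE szq.
  by rewrite lead_coef_eq0 -size_poly_eq0 szq.
have intK : injective (intr : int -> K).
  move=> a b; rewrite -!(rmorph_int (in_alg K)) => /fmorph_inj; exact: intr_inj.
have qx : (q`_0)%:~R + (q`_1)%:~R * x + (q`_2)%:~R * x ^+ 2 + (q`_3)%:~R * x ^+ 3 = 0 :> K.
  have : root (map_poly (intr : int -> K) q) x.
    move: px; rewrite qE map_polyZ /= rootZ; last first.
      by rewrite scaler_eq0 oner_eq0 orbF invr_eq0.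
    rewrite -map_poly_comp; congr (root _ _); apply: eq_map_poly => z /=.
    by rewrite alg_num_field ratr_int.
  rewrite /root horner_coef size_map_inj_poly // ?szq.
  rewrite !big_ord_recl big_ord0 !coef_map /= => /eqP <-.
  by rewrite /bump /= expr0 expr1 mulr1 addr0 !addrA.
(* Multiplying the cubic equation of [x] by the square of its leading coefficient gives a monic
   equation for [y]. *)
pose y : K := (q`_3)%:~R * x.
have yE : (q`_0)%:~R * (q`_3)%:~R ^+ 2 + (q`_1)%:~R * (q`_3)%:~R * y + (q`_2)%:~R * y ^+ 2 + y
  ^+ 3 = 0 :> K.
  have : (q`_3)%:~R ^+ 2 * ((q`_0)%:~R + (q`_1)%:~R * x + (q`_2)%:~R * x ^+ 2 + (q`_3)%:~R * x
    ^+ 3) = 0 :> K.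
    by rewrite qx mulr0.
  by rewrite /y => <-; ring.
have Ps : polyseq (Poly [:: q`_0 * q`_3 ^+ 2; q`_1 * q`_3; q`_2; 1]) = [:: q`_0 * q`_3 ^+ 2;
  q`_1 * q`_3; q`_2; 1].
  by rewrite (PolyK (c := 0)).
exists y; split.
  exists (Poly [:: q`_0 * q`_3 ^+ 2; q`_1 * q`_3; q`_2; 1]); split.
    by rewrite monicE lead_coefE Ps.
  rewrite /root map_Poly_id0 // horner_Poly /= !rmorphM /= rmorph1.
  by apply/eqP; rewrite -[RHS]yE; ring.
apply: contra xn => yQ; have -> : x = ((q`_3)%:~R)^-1 * y.
  rewrite /y mulKf //; apply: contra_neq q3 => h.
  by apply: intK; rewrite h.
by rewrite -(rmorph_int (in_alg K)) -fmorphV /= mulr_algl memvZ.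
Qed.

(** * Discreteness of the lattice, and totally positive points close to a coordinate axis *)

Local Notation V := 'rV[R]_3.
Local Notation L := (Lambda tau).

Lemma Lambda_sub (v w : V) : L v -> L w -> L (v - w).
Proof.
move=> [a [ai ->]] [b [bi ->]]; exists (a - b); split; first exact: integralZ_sub.
by apply/rowP => i; rewrite !mxE rmorphB.
Qed.

Lemma Lambda_norm (v : V) : L v -> v != 0 -> 1 <= `|v 0 0 * v 0 1 * v 0 2%:R|.
Proof.
move=> [a [ai ->]] v0; rewrite !mxE; apply: tau_norm_ge1 => //.
by apply: contra_neq v0 => ->; apply/rowP => i; rewrite !mxE rmorph0.
Qed.

(** Cut the box into cells of side 1/2. Two lattice points of one cell differ by a vector of norm
    form below 1/8 in absolute value, so they coincide. *)
Lemma Lambda_finite (B : R) : finite_set [set v : V | L v /\ forall i, `|v 0 i| <= B].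
Proof.
set A := [set v | _].
pose M := Num.truncn (4 * B).
pose g (x : R) := Num.truncn ((x + B) * 2).
have gM x : `|x| <= B -> (g x < M.+1)%N.
  rewrite ler_norml => /andP[x1 x2]; rewrite ltnS; apply: le_truncn; lra.
(* Points outside [A] get [None], so that [A] is the preimage of a finite set. *)
pose cell (v : V) : option ('I_M.+1 * 'I_M.+1 * 'I_M.+1) :=
  if `[< A v >] then Some (inord (g (v 0 0)), inord (g (v 0 1)), inord (g (v 0 2%:R))) else None.
have AE : A = cell @^-1` [set o | o <> None].
  apply/seteqP; split=> v; rewrite /= /cell; first by move=> /asboolP ->.
  by case: asboolP.
rewrite AE; apply: finite_preimage; last exact: finite_finset.
rewrite -AE => v w /[!inE] vA wA; rewrite /cell !asboolT //.
move=> /Some_inj/eqP; rewrite !xpair_eqE -!val_eqE /=.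
case: vA wA => vL vB [wL wB]; rewrite !inordK ?gM // => /andP[/andP[/eqP e0 /eqP e1] /eqP e2].
have close x y : `|x| <= B -> `|y| <= B -> g x = g y -> `|x - y| < 1 / 2.
  rewrite !ler_norml => /andP[x1 x2] /andP[y1 y2] e.
  have : `|(x + B) * 2 - (y + B) * 2| < 1 by apply: truncn_close e; lra.
  by rewrite !ltr_norml => /andP[h1 h2]; apply/andP; split; lra.
apply/subr0_eq/eqP/negPn/negP => vw.
have := Lambda_norm (Lambda_sub vL wL) vw; rewrite leNgt => /negP; apply.
rewrite !mxE !normrM.
have h0 := close _ _ (vB 0) (wB 0) e0; have h1 := close _ _ (vB 1) (wB 1) e1.
have h2 := close _ _ (vB 2%:R) (wB 2%:R) e2.
apply: le_lt_trans (_ : (1/2) * (1/2) * (1/2) < 1); last by lra.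
apply: ler_pM (ltW h2); rewrite ?mulr_ge0 //.
by apply: ler_pM (ltW h0) (ltW h1).
Qed.

Lemma Lambda_pos_norm (v : V) : L v -> posorth v -> 1 <= v 0 0 * v 0 1 * v 0 2%:R.
Proof.
move=> vL vp; have := Lambda_norm vL; rewrite ger0_norm; last by rewrite !mulr_ge0 // ltW.
by apply; apply/eqP => v0; have := vp 0; rewrite v0 mxE ltxx.
Qed.

(** Dirichlet's approximation gives a nonzero integer of [K] of the form [n0 + n1 a + n2 a^2] with
    two small conjugates; its square is totally positive. *)
Lemma Lambda_small (i : 'I_3) (eps : R) : 0 < eps ->
  exists v : V, [/\ L v, posorth v & forall j, j != i -> v 0 j < eps].
Proof.
(* The bound 1 makes the square of a conjugate no larger than its absolute value. *)
move=> e0; pose e := Num.min eps 1; have e1 : 0 < e by rewrite lt_min e0 ltr01.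
have [a [ai an]] := exists_integral_nonrational.
have [j [k [ij ik hjk]]] : exists j k : 'I_3, [/\ j != i, k != i & forall l,
  l != i -> l = j \/ l = k].
  elim/ord3P: i.
  - by exists 1, 2%:R; split=> //; elim/ord3P; auto.
  - by exists 0, 2%:R; split=> //; elim/ord3P; auto.
  - by exists 0, 1; split=> //; elim/ord3P; auto.
have [n [[m nm] nz]] := quadratic_simultaneous_approx (tau j a) (tau k a) e1.
pose b : K := (n 0)%:~R + (n 1)%:~R * a + (n 2%:R)%:~R * a ^+ 2.
have bE l : tau l b = (n 0)%:~R + (n 1)%:~R * tau l a + (n 2%:R)%:~R * tau l a ^+ 2.
  by rewrite /b !rmorphD !rmorphM !rmorph_int.
have intZ (z : int) : integralZ (z%:~R : K) by apply/integralZP/integral_id.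
have bi : integralZ b.
  rewrite /b expr2; apply: integralZ_add; first apply: integralZ_add => //.
    exact: integralZ_mul.
  by apply: integralZ_mul => //; apply: integralZ_mul.
have b0 : b != 0.
  (* Otherwise a polynomial of degree at most 2 with a nonzero coefficient would have the three
     distinct roots [tau l a]. *)
  apply/eqP => b0; move/negP: nm; apply.
  pose p : {poly R} := Poly [:: (n 0)%:~R; (n 1)%:~R; (n 2%:R)%:~R].
  have pr l : root p (tau l a).
    apply/eqP; rewrite horner_Poly /= -[RHS](rmorph0 (tau l)) -b0 bE; ring.
  have p0 : p = 0.
    apply: (@roots_geq_poly_eq0 _ p [:: tau 0 a; tau 1 a; tau 2%:R a]).
    - by rewrite /= !pr.
    - by rewrite /= !inE !negb_or !tau_sep.
    - by rewrite (leq_trans (size_Poly _)).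
  have pc l : p`_l = 0 by rewrite p0 coef0.
  move: m; apply: ord3P; apply/eqP/(@intr_inj R).
  - by have := pc 0%N; rewrite coef_Poly.
  - by have := pc 1%N; rewrite coef_Poly.
  - by have := pc 2%N; rewrite coef_Poly.
exists (iotaM tau (b ^+ 2)); split.
- by exists (b ^+ 2); split=> //; rewrite expr2; apply: integralZ_mul.
- by move=> l; rewrite mxE rmorphXn exprn_even_gt0 //= fmorph_eq0.
move=> l li; rewrite mxE rmorphXn /= -real_normK ?num_real //.
have : `|tau l b| < e.
  by rewrite bE; apply: nz; case: (hjk l li) => ->; [left|right].
rewrite lt_min => /andP[h1 h2].
by apply: le_lt_trans h1; rewrite expr2 ler_piMl // ltW.
Qed.

End Arithmetic.

(** * Cones and triangulations of lattice polygons *)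

Section Cones.
Variable R : realType.
Local Notation V := 'rV[R]_3.
Local Notation conv := (@Defs.conv R).

Lemma dotvE (u x : V) : dotv u x = u 0 0 * x 0 0 + u 0 1 * x 0 1 + u 0 2%:R * x 0 2%:R.
Proof. by rewrite /dotv mxE sum3 !mxE. Qed.

Lemma dotvD (u x y : V) : dotv u (x + y) = dotv u x + dotv u y.
Proof. by rewrite !dotvE !mxE; ring. Qed.

Lemma dotvB (u x y : V) : dotv u (x - y) = dotv u x - dotv u y.
Proof. by rewrite !dotvE !mxE; ring. Qed.

Lemma dotvZ (u x : V) k : dotv u (k *: x) = k * dotv u x.
Proof. by rewrite !dotvE !mxE; ring. Qed.

Lemma dotv0 (u : V) : dotv u 0 = 0.
Proof. by rewrite !dotvE !mxE; ring. Qed.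

Lemma dotv_sum (u : V) I (r : seq I) (P : pred I) (f : I -> V) :
  dotv u (\sum_(i <- r | P i) f i) = \sum_(i <- r | P i) dotv u (f i).
Proof. by apply: (big_morph (dotv u)) => [x y|]; rewrite ?dotvD ?dotv0. Qed.

Definition rows3 (a b c : V) : 'M[R]_3 :=
  \matrix_(i < 3) (if i == 0 then a else if i == 1 then b else c).

Lemma mul_rows3 (w a b c : V) :
  w *m rows3 a b c = w 0 0 *: a + w 0 1 *: b + w 0 2%:R *: c.
Proof. by apply/rowP => j; rewrite !mxE sum3 !mxE. Qed.

Definition row3 (x y z : R) : V :=
  \row_i (if i == 0 then x else if i == 1 then y else z).

Lemma mul_row3 x y z a b c : row3 x y z *m rows3 a b c = x *: a + y *: b + z *: c.
Proof. by rewrite mul_rows3 !mxE. Qed.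

(** The determinant with rows [p], [q], [r], expanded so that identities between determinants follow
    by [ring]. *)
Definition det3 (p q r : V) : R :=
  p 0 0 * (q 0 1 * r 0 2%:R - q 0 2%:R * r 0 1)
  - p 0 1 * (q 0 0 * r 0 2%:R - q 0 2%:R * r 0 0)
  + p 0 2%:R * (q 0 0 * r 0 1 - q 0 1 * r 0 0).

Lemma det_rows3 p q r : \det (rows3 p q r) = det3 p q r.
Proof.
rewrite (expand_det_row _ 0) sum3 /cofactor !(expand_det_row _ 0) !big_ord_recl !big_ord0.
rewrite /cofactor !det_mx11 !mxE /= /bump /= /det3 !expr0 !expr1.
have vE (v : V) (i j : 'I_3) : val i = val j -> v 0 i = v 0 j by move=> /val_inj ->.
rewrite (vE q (lift 0 ord0) 1) // (vE q (lift 0 (lift ord0 ord0)) 2%:R) //.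
rewrite (vE q (lift 1 ord0) 0) // (vE q (lift 1 (lift ord0 ord0)) 2%:R) //.
rewrite (vE q (lift 2%:R ord0) 0) // (vE q (lift 2%:R (lift ord0 ord0)) 1) //.
rewrite (vE r (lift 0 (lift ord0 0)) 2%:R) // (vE r (lift 0 (lift (lift ord0 ord0) 0)) 1) //.
rewrite (vE r (lift 1 (lift ord0 0)) 2%:R) // (vE r (lift 1 (lift (lift ord0 ord0) 0)) 0) //.
rewrite (vE r (lift 2%:R (lift ord0 0)) 1) // (vE r (lift 2%:R (lift (lift ord0 ord0) 0)) 0) //.
rewrite (_ : (-1) ^+ _ = 1); last by rewrite (_ : (_ + _)%N = 2%N) // expr2 mulrNN mulr1.
ring.
Qed.

Lemma rows3_unit p q r : (rows3 p q r \in unitmx) = (det3 p q r != 0).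
Proof. by rewrite unitmxE det_rows3 unitfE. Qed.

Lemma det3_eq0 p q r : det3 p q r = 0 ->
  exists x y z, ~ [/\ x = 0, y = 0 & z = 0] /\ x *: p + y *: q + z *: r = 0.
Proof.
rewrite -det_rows3 => /eqP/det0P[w w0 /[!mul_rows3] e].
exists (w 0 0), (w 0 1), (w 0 2%:R); split=> // -[h0 h1 h2].
by move/eqP: w0; apply; apply/rowP; apply: ord3P; rewrite mxE.
Qed.

Section Plane.
Variables (u : V) (c : R).
Hypothesis c0 : 0 < c.

(** The vertices have the same nonzero height, so the coefficients of a linear relation among them
    sum to zero; such a relation is a relation between the two edge vectors. *)
Lemma tri_rank_det a b d : dotv u a = c -> dotv u b = c -> dotv u d = c ->
  (\rank (col_mx (b - a) (d - a)) = 2%N) <-> det3 a b d != 0.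
Proof.
move=> ua ub ud; rewrite -rows3_unit.
have mulE (w : 'rV[R]_(1 + 1)) : w *m col_mx (b - a) (d - a) =
   row3 (- w 0 (lshift 1 0) - w 0 (rshift 1 0)) (w 0 (lshift 1 0)) (w 0 (rshift 1 0)) *m rows3 a
     b d.
  rewrite -[w in LHS]hsubmxK mul_row_col [lsubmx w]mx11_scalar [rsubmx w]mx11_scalar.
  by rewrite !mul_scalar_mx mul_row3; apply/rowP => j; rewrite !mxE; ring.
split=> [rk|un].
  rewrite -row_free_unit; apply: inj_row_free => w wE.
  have /eqP s0 : w 0 0 + w 0 1 + w 0 2%:R == 0.
    have := congr1 (dotv u) wE; rewrite mul_rows3 !dotvD !dotvZ dotv0 ua ub ud => /eqP.
    by rewrite -!mulrDl mulf_eq0 (gt_eqF c0) orbF.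
  have fr : row_free (col_mx (b - a) (d - a)) by rewrite /row_free rk.
  have : row_mx (w 0 1)%:M (w 0 2%:R)%:M *m col_mx (b - a) (d - a) = 0.
    rewrite mulE -wE; congr (_ *m _); apply/rowP; rewrite !row_mxEl !row_mxEr.
    by apply: ord3P; rewrite !mxE /= ?mulr1n //; move: s0; lra.
  move/eqP; rewrite mulmx_free_eq0 // => /eqP w0.
  have w1 : w 0 1 = 0.
    by have := congr1 (fun m : 'rV_(1 + 1) => m 0 (lshift 1 0)) w0; rewrite row_mxEl !mxE mulr1n.
  have w2 : w 0 2%:R = 0.
    by have := congr1 (fun m : 'rV_(1 + 1) => m 0 (rshift 1 0)) w0; rewrite row_mxEr !mxE mulr1n.
  by apply/rowP; apply: ord3P; rewrite mxE //; move: s0; rewrite w1 w2; lra.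
apply/eqP/inj_row_free => w; rewrite mulE => /(congr1 (mulmx^~ (invmx (rows3 a b d)))).
rewrite mulmxK // mul0mx => wE; apply/rowP => i; rewrite !mxE.
case: (split_ordP i) => j ->; rewrite ord1.
- by have := congr1 (fun m : V => m 0 1) wE; rewrite !mxE.
- by have := congr1 (fun m : V => m 0 2%:R) wE; rewrite !mxE.
Qed.

End Plane.

(** Inductive form of finite nonnegative combinations: closure properties become inductions, and no
    weights need to be normalised. *)
Inductive cone (T : set V) : set V :=
| cone0 : cone T 0
| cone_cons w p x : 0 <= w -> T p -> cone T x -> cone T (w *: p + x).

Lemma cone_add T x y : cone T x -> cone T y -> cone T (x + y).
Proof.
move=> Tx Ty; elim: Tx => [|w p z w0 Tp _ ih]; first by rewrite add0r.
by rewrite -addrA; apply: cone_cons.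
Qed.

Lemma cone_scale T k x : 0 <= k -> cone T x -> cone T (k *: x).
Proof.
move=> k0; elim=> [|w p z w0 Tp _ ih]; first by rewrite scaler0; exact: cone0.
by rewrite scalerDr scalerA; apply: cone_cons => //; apply: mulr_ge0.
Qed.

Lemma cone_gen T x : T x -> cone T x.
Proof. by move=> Tx; rewrite -[x]scale1r -[_ *: _]addr0; apply: cone_cons => //;
  apply: cone0. Qed.

Lemma cone_trans T T' : T `<=` cone T' -> cone T `<=` cone T'.
Proof.
move=> TT' x; elim=> [|w p z w0 Tp _ ih]; first exact: cone0.
by apply: cone_add => //; apply: cone_scale => //; apply: TT'.
Qed.

Lemma cone_sub T T' : T `<=` T' -> cone T `<=` cone T'.
Proof. by move=> TT'; apply: cone_trans => x /TT'; apply: cone_gen. Qed.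

(** When all generators have height [c], the weights sum to 1 exactly when the combination has
    height [c]. *)
Lemma conv_coneP (u : V) (c : R) (T : set V) x : 0 < c -> (forall p, T p -> dotv u p = c) ->
  conv T x <-> cone T x /\ dotv u x = c.
Proof.
move=> c0 Tc; split=> [[n [p [w [Tp [w0 [w1 ->]]]]]]|[Cx]].
  split.
    apply: big_ind => [|y z|i _]; [exact: cone0|exact: cone_add|].
    by apply: cone_scale => //; apply: cone_gen.
  rewrite dotv_sum (eq_bigr (fun i => w i * c)); last by move=> i _; rewrite dotvZ Tc.
  by rewrite -mulr_suml w1 mul1r.
have [n [p [w [Tp w0 xE]]]] : exists (n : nat) (p : 'I_n -> V) (w : 'I_n -> R),
    [/\ forall i, T (p i), forall i, 0 <= w i & x = \sum_i w i *: p i].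
  have [s sT sE] : exists2 s : seq (R * V),
      (forall z, z \in s -> 0 <= z.1 /\ T z.2) & x = \sum_(z <- s) z.1 *: z.2.
    elim: Cx => [|w p y w0 Tp _ [s sT ->]]; first by exists [::]; rewrite ?big_nil.
    exists ((w, p) :: s); last by rewrite big_cons.
    by move=> z; rewrite inE => /orP[/eqP ->|/sT].
  exists (size s), (fun i => (tnth (in_tuple s) i).2), (fun i => (tnth (in_tuple s) i).1).
  have st i : tnth (in_tuple s) i \in s by rewrite mem_tnth.
  split=> [i|i|]; [by have [] := sT _ (st i)|by have [] := sT _ (st i)|].
  by rewrite sE big_tnth.
rewrite xE dotv_sum (eq_bigr (fun i => w i * c)); last by move=> i _; rewrite dotvZ Tc.
rewrite -mulr_suml => h; exists n, p, w; split=> //; split=> //; split=> //.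
by apply: (mulIf (lt0r_neq0 c0)); rewrite h mul1r.
Qed.

(** For points of a plane at positive height this is convex position: every point is a vertex of the
    convex hull. *)
Definition irredundant (s : seq V) :=
  forall v, v \in s -> ~ cone [set x | x \in s /\ x <> v] v.

Lemma irredundant_sub (s s' : seq V) : {subset s' <= s} -> irredundant s -> irredundant s'.
Proof.
move=> ss irr v /ss /irr H; apply: contra_not H; apply: cone_sub => x /= [/ss ? ?] //.
Qed.

Definition verts (t : V * V * V) : set V :=
  let: (a, b, c) := t in [set x | x = a \/ x = b \/ x = c].

(** * Triangulating a convex polygon given by its vertices *)

Section Triangulation.
Variables (u : V) (c : R).
Hypothesis c0 : 0 < c.

(** Three collinear points satisfy a nontrivial relation with coefficient sum zero, which puts one
    of them between the other two. *)
Lemma irredundant_det3 (s : seq V) (p q r : V) : irredundant s ->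
  (forall v, v \in s -> dotv u v = c) -> p \in s -> q \in s -> r \in s ->
  p != q -> p != r -> q != r -> det3 p q r != 0.
Proof.
move=> irr su ps qs rs /eqP pq /eqP pr /eqP qr; apply/eqP => /det3_eq0[x [y [z [n0 e]]]].
have /eqP s0 : x + y + z == 0.
  have := congr1 (dotv u) e; rewrite !dotvD !dotvZ dotv0 !su // => /eqP.
  by rewrite -!mulrDl mulf_eq0 (gt_eqF c0) orbF.
(* A point whose coefficient has the sign opposite to the other two lies in the cone of those
   two. *)
have key (a b d : V) (k l m : R) : a \in s -> b \in s -> d \in s -> b <> a -> d <> a ->
    k *: a + l *: b + m *: d = 0 -> 0 < k -> l <= 0 -> m <= 0 -> False.
  move=> as_ bs ds ab ad kE k0 l0 m0; apply: (irr _ as_).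
  rewrite [X in cone _ X](_ : a = k^-1 *: ((- l) *: b + (- m) *: d)); last first.
    apply: (@scalerI _ _ k); first exact: lt0r_neq0.
    rewrite scalerA divff ?lt0r_neq0 // scale1r; apply/eqP; rewrite -subr_eq0 -kE.
    by apply/eqP/rowP => j; rewrite !mxE; ring.
  apply: cone_scale; first by rewrite invr_ge0 ltW.
  by apply: cone_add; apply: cone_scale; rewrite ?oppr_ge0 //; apply: cone_gen; split.
have e1 : y *: q + x *: p + z *: r = 0 by rewrite -[RHS]e; apply/rowP => j; rewrite !mxE; ring.
have e2 : z *: r + x *: p + y *: q = 0 by rewrite -[RHS]e; apply/rowP => j; rewrite !mxE; ring.
have en (a b d : V) (k l m : R) : k *: a + l *: b + m *: d = 0 ->
  (- k) *: a + (- l) *: b + (- m) *: d = 0.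
  move=> h; apply/eqP; rewrite -oppr_eq0; apply/eqP; rewrite -[RHS]h.
  by apply/rowP => j; rewrite !mxE; ring.
(* Up to negating the relation, every sign pattern has such a point, except three positive or three
   nonpositive coefficients, which the zero sum and nontriviality exclude. *)
case: (ltrP 0 x) => hx; case: (ltrP 0 y) => hy; case: (ltrP 0 z) => hz.
- by move: hx hy hz s0; clear; lra.
- by apply: (key r p q _ _ _ rs ps qs _ _ (en _ _ _ _ _ _ e2)); rewrite ?oppr_gt0 ?oppr_le0 //;
  move: hx hy hz s0; clear; lra.
- by apply: (key q p r _ _ _ qs ps rs _ _ (en _ _ _ _ _ _ e1)); rewrite ?oppr_gt0 ?oppr_le0 //;
  [exact/nesym|move: hx hy hz s0; clear; lra..].
- by apply: (key p q r _ _ _ ps qs rs _ _ e) => //; exact/nesym.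
- by apply: (key p q r _ _ _ ps qs rs _ _ (en _ _ _ _ _ _ e)); rewrite ?oppr_gt0 ?oppr_le0 //;
  [exact/nesym|exact/nesym|move: hx hy hz s0; clear; lra..].
- by apply: (key q p r _ _ _ qs ps rs _ _ e1) => //; exact/nesym.
- by apply: (key r p q _ _ _ rs ps qs _ _ e2).
- by apply: n0; split; move: hx hy hz s0; clear; lra.
Qed.

(** If no line through [p] and one of the other points separated the remaining two, the three
    determinants would have pairwise negative products, which is impossible for three real
    numbers. *)
Lemma exists_separating p q r t : det3 p q r != 0 -> det3 p r t != 0 -> det3 p t q != 0 ->
  exists q' r' t', [/\ {subset [:: q'; r'; t'] <= [:: q; r;
    t]}, 0 < det3 p q' r' & det3 p q' t' < 0].
Proof.
have E a b : det3 p a b = - det3 p b a by rewrite /det3; ring.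
have sep a b d : {subset [:: a; b; d] <= [:: q; r; t]} -> det3 p a b * det3 p a d < 0 ->
    exists q' r' t', [/\ {subset [:: q'; r'; t'] <= [:: q; r;
      t]}, 0 < det3 p q' r' & det3 p q' t' < 0].
  move=> abd; have [h h'|h h'|<-] := ltgtP 0 (det3 p a b); last by rewrite mul0r ltxx.
    by exists a, b, d; split=> //; rewrite pmulr_rlt0 in h'.
  exists a, d, b; split=> //; last by rewrite nmulr_rlt0 in h'.
  by move=> z zi; apply: abd; move: zi; rewrite !inE => /or3P[] ->; rewrite ?orbT.
have [h1|h1] := ltrP (det3 p q r * det3 p q t) 0; first by move=> _ _ _; apply: (sep q r t).
have [h2|h2] := ltrP (det3 p r q * det3 p r t) 0.
  by move=> _ _ _; apply: (sep r q t) => // z; rewrite !inE => /or3P[] ->; rewrite ?orbT.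
have [h3|h3] := ltrP (det3 p t q * det3 p t r) 0.
  by move=> _ _ _; apply: (sep t q r) => // z; rewrite !inE => /or3P[] ->; rewrite ?orbT.
move: h1 h2 h3; rewrite (E q t) (E r q) (E t r).
set e1 := det3 p q r; set e2 := det3 p r t; set e3 := det3 p t q => h1 h2 h3 n1 n2 n3.
have p1 : 0 < e1 ^+ 2 by rewrite exprn_even_gt0.
have b1 : e1 * e3 < 0 by rewrite lt_neqAle mulf_neq0 //= ; move: h1; lra.
have b2 : e1 * e2 < 0 by rewrite lt_neqAle mulf_neq0 //= ; move: h2; lra.
have b3 : e3 * e2 < 0 by rewrite lt_neqAle mulf_neq0 //= ; move: h3; lra.
have : 0 < (e1 * e3) * (e1 * e2) by rewrite nmulr_rgt0.
have -> : (e1 * e3) * (e1 * e2) = e1 ^+ 2 * (e3 * e2) by ring.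
by rewrite pmulr_rgt0 //; lra.
Qed.

(** * Cutting a polygon along the line through two of its vertices *)

Section Split.
Variables (s : seq V) (p q : V).
Hypotheses (irr : irredundant s) (su : forall v, v \in s -> dotv u v = c).
Hypotheses (ps : p \in s) (qs : q \in s) (pq : p != q).
Local Notation l := (det3 p q).

Lemma mem_split_line x : x \in s -> l x = 0 -> x = p \/ x = q.
Proof.
move=> xs lx; have [->|xp] := eqVneq x p; first by left.
have [->|xq] := eqVneq x q; first by right.
have := irredundant_det3 irr su ps qs xs pq; rewrite lx eqxx => H.
by have := H; rewrite ![_ == x]eq_sym => /(_ xp xq).
Qed.

(* A segment joining the two sides of the line [pq] crosses it between [p] and [q]:
   otherwise [p] or [q] would be redundant. *)
Lemma split_crossing x y : x \in s -> y \in s -> 0 <= l x -> l y <= 0 ->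
  cone [set z | z = p \/ z = q] (l x *: y - l y *: x).
Proof.
move=> xs ys lx ly.
(* Cramer's relation among the four vectors [p], [q], [x], [y]. It remains to find the signs of the
   two coefficients on the right. *)
have cramer : l x *: y - l y *: x = det3 q x y *: p - det3 p x y *: q.
  by apply/rowP; apply: ord3P; rewrite !mxE /det3; ring.
have uE : l x - l y = det3 q x y - det3 p x y.
  apply: (mulIf (lt0r_neq0 c0)); have := congr1 (dotv u) cramer.
  by rewrite !dotvB !dotvZ !su // -!mulrBl.
suff [A B] : 0 <= det3 q x y /\ det3 p x y <= 0.
  rewrite cramer -scaleNr; apply: cone_add; apply: cone_scale; rewrite ?oppr_ge0 //.
  - by apply: cone_gen; left.
  - by apply: cone_gen; right.
have [lx0|lx0] := eqVneq (l x) 0.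
  case: (mem_split_line xs lx0) => ->; split; move: ly; rewrite /det3; lra.
have [ly0|ly0] := eqVneq (l y) 0.
  case: (mem_split_line ys ly0) => ->; split; move: lx; rewrite /det3; lra.
have {}lx : 0 < l x by rewrite lt_neqAle eq_sym lx0.
have {}ly : l y < 0 by rewrite lt_neqAle ly0.
have lp : l p = 0 by rewrite /det3; ring.
have lq : l q = 0 by rewrite /det3; ring.
have xp : x <> p by move=> e; move: lx; rewrite e lp ltxx.
have xq : x <> q by move=> e; move: lx; rewrite e lq ltxx.
have yp : y <> p by move=> e; move: ly; rewrite e lp ltxx.
have yq : y <> q by move=> e; move: ly; rewrite e lq ltxx.
set A := det3 q x y in cramer uE *; set B := det3 p x y in cramer uE *.
have cramer' : l x *: y + (- l y) *: x = A *: p - B *: q by rewrite scaleNr.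
split; rewrite leNgt; apply/negP => h.
  apply: (irr qs); rewrite [X in cone _ X](_ : q = (- B)^-1 *: (l x *: y + (- l y) *: x + (- A)
    *: p)).
    have B0 : 0 < - B by lra.
    apply: cone_scale; first by rewrite invr_ge0 ltW.
    by do 2?apply: cone_add; apply: cone_scale; try lra; apply: cone_gen; split=> //; apply/eqP.
  have B0 : - B != 0 by lra.
  apply: (scalerI B0); rewrite scalerA divff // scale1r cramer'.
  by apply/rowP => j; rewrite !mxE; ring.
apply: (irr ps); rewrite [X in cone _ X](_ : p = A^-1 *: (l x *: y + (- l y) *: x + B *: q)).
  have A0 : 0 < A by lra.
  apply: cone_scale; first by rewrite invr_ge0 ltW.
  by do 2?apply: cone_add; apply: cone_scale; try lra; apply: cone_gen; split=> //;
    apply/nesym/eqP.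
have A0 : A != 0 by lra.
apply: (scalerI A0); rewrite scalerA divff // scale1r cramer'.
by apply/rowP => j; rewrite !mxE; ring.
Qed.

Let S1 := [set z | z \in s /\ 0 <= l z].
Let S2 := [set z | z \in s /\ l z <= 0].

Let lD x y : l (x + y) = l x + l y.
Proof. by rewrite /det3 !mxE; ring. Qed.

Let lZ k x : l (k *: x) = k * l x.
Proof. by rewrite /det3 !mxE; ring. Qed.

Let l0 : l 0 = 0.
Proof. by rewrite /det3 !mxE; ring. Qed.

(** The vector is bilinear in [y] and [z], so the case of two vertices extends to both cones by a
    double induction. *)
Lemma split_crossing_cone y z : cone S1 y -> cone S2 z ->
  cone [set z | z = p \/ z = q] (l y *: z - l z *: y).
Proof.
move=> Cy Cz; elim: Cy => [|w x y' w0 [xs lx] _ ih].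
  by rewrite l0 scale0r scaler0 subr0; apply: cone0.
rewrite (_ : _ - _ = w *: (l x *: z - l z *: x) + (l y' *: z - l z *: y')); last first.
  by apply/rowP => j; rewrite !mxE lD lZ; ring.
apply: cone_add ih; apply: cone_scale => //.
elim: Cz => [|w' x' z' w0' [xs' lx'] _ ih'].
  by rewrite l0 scale0r scaler0 subr0; apply: cone0.
rewrite (_ : _ - _ = w' *: (l x *: x' - l x' *: x) + (l x *: z' - l z' *: x)); last first.
  by apply/rowP => j; rewrite !mxE lD lZ; ring.
by apply: cone_add ih'; apply: cone_scale => //; apply: split_crossing.
Qed.

Lemma cone_split_ge0 y : cone S1 y -> 0 <= l y.
Proof. by elim=> [|w x z w0 [_ lx] _ ih]; rewrite ?l0 // lD lZ addr_ge0 // mulr_ge0. Qed.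

Lemma cone_split_le0 y : cone S2 y -> l y <= 0.
Proof.
elim=> [|w x z w0 [_ lx] _ ih]; rewrite ?l0 // lD lZ.
by rewrite -oppr_ge0 opprD addr_ge0 ?oppr_ge0 // mulr_ge0_le0.
Qed.

(** The crossing vector [l y *: z - l z *: y] lies in the cone of [p] and [q], hence in both halves.
    According to which of [y] and [z] is farther from the line, [y + z] is a nonnegative combination
    of it with [y] or with [z]. *)
Lemma split_cone_add y z : cone S1 y -> cone S2 z -> cone S1 (y + z) \/ cone S2 (y + z).
Proof.
move=> Cy Cz; have := split_crossing_cone Cy Cz.
have ly := cone_split_ge0 Cy; have lz := cone_split_le0 Cz => Cpq.
have lp : l p = 0 by rewrite /det3; ring.
have lq : l q = 0 by rewrite /det3; ring.
have C1 : cone S1 (l y *: z - l z *: y).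
  by apply: cone_sub Cpq => x /= [->|->]; split; rewrite // ?lp ?lq.
have C2 : cone S2 (l y *: z - l z *: y).
  by apply: cone_sub Cpq => x /= [->|->]; split; rewrite // ?lp ?lq.
have [h|h] := lerP (- l z) (l y).
  (* Degenerate case [l y = l z = 0]: the generators of [z] with nonzero weight lie on the line, so
     they belong to [S1] too. *)
  have [ly0|ly0] := eqVneq (l y) 0.
    left; apply: cone_add => //; have lz0 : l z = 0 by lra.
    move: lz0; elim: (Cz) => [|w x z' w0 [xs lx] Cz' ih]; first by move=> _; apply: cone0.
    rewrite lD lZ => e; have lz' := cone_split_le0 Cz'.
    have wl : w * l x <= 0 by rewrite mulr_ge0_le0.
    apply: cone_add; last by apply: ih; lra.
    have /eqP : w * l x = 0 by lra.
    rewrite mulf_eq0 => /orP[/eqP ->|/eqP lx0]; first by rewrite scale0r; apply: cone0.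
    by apply: cone_scale => //; apply: cone_gen; split=> //; rewrite lx0.
  left; rewrite (_ : y + z = (1 + l z / l y) *: y + (l y)^-1 *: (l y *: z - l z *: y));
    last first.
    by apply/rowP => j; rewrite !mxE; field.
  have ly1 : 0 < l y by rewrite lt_neqAle eq_sym ly0.
  apply: cone_add; apply: cone_scale; rewrite ?invr_ge0 //.
  by rewrite -[X in X + _](divff ly0) -mulrDl divr_ge0 //; lra.
have lz1 : 0 < - l z by lra.
have lz0 : l z != 0 by lra.
right; rewrite (_ : y + z = (1 + l y / l z) *: z + (- l z)^-1 *: (l y *: z - l z *: y));
  last first.
  by apply/rowP => j; rewrite !mxE; field.
apply: cone_add; apply: cone_scale; rewrite ?invr_ge0 ?(ltW lz1) //.
rewrite -[X in X + _](divff lz0) -mulrDl -mulrNN -invrN divr_ge0 //; lra.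
Qed.

Lemma cone_split x : cone [set` s] x -> cone S1 x \/ cone S2 x.
Proof.
elim=> [|w y z w0 /= ys _ [ih|ih]]; first by left; apply: cone0.
- have [ly|ly] := lerP 0 (l y).
    by left; apply: cone_cons.
  by rewrite addrC; apply: split_cone_add => //; apply: cone_scale => //; apply: cone_gen;
    split=> //; apply: ltW.
- have [ly|ly] := lerP (l y) 0.
    by right; apply: cone_cons.
  by apply: split_cone_add => //; apply: cone_scale => //; apply: cone_gen; split=> //;
    apply: ltW.
Qed.

End Split.
Definition disjoint_interiors (D : seq (V * V * V)) :=
  forall i j, (i < size D)%N -> (j < size D)%N -> i != j ->
    tri_relint (nth (0, 0, 0) D i) `&` tri_relint (nth (0, 0, 0) D j) = set0.

Lemma disjoint_interiors_cat D1 D2 : disjoint_interiors D1 -> disjoint_interiors D2 ->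
  (forall t1 t2, t1 \in D1 -> t2 \in D2 -> tri_relint t1 `&` tri_relint t2 = set0) ->
  disjoint_interiors (D1 ++ D2).
Proof.
move=> d1 d2 d12 i j; rewrite size_cat !nth_cat => hi hj ij.
have [i1|i1] := ltnP i (size D1); have [j1|j1] := ltnP j (size D1).
- exact: d1.
- by apply: d12; rewrite mem_nth // ltn_subLR.
- by rewrite setIC; apply: d12; rewrite mem_nth // ltn_subLR.
- apply: d2; rewrite ?ltn_subLR //; apply: contra_neq ij => e.
  by rewrite -(subnKC i1) e subnKC.
Qed.

(** Strong induction on the number of vertices: a line through two vertices, with vertices strictly
    on both sides, cuts [s] into two smaller irredundant sets. Covering is stated for cones, the
    form that convex hulls take here. *)
Lemma triangulation (s : seq V) : uniq s -> (2 < size s)%N ->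
  (forall v, v \in s -> dotv u v = c) -> irredundant s ->
  exists D : seq (V * V * V),
    [/\ forall t, t \in D -> [/\ t.1.1 \in s, t.1.2 \in s, t.2 \in s & det3 t.1.1 t.1.2 t.2 != 0],
       forall x, cone [set` s] x -> exists2 t, t \in D & cone (verts t) x
     & disjoint_interiors D].
Proof.
have [n] := ubnP (size s); elim: n s => // n ih s; rewrite ltnS => sn us s2 su irr.
have det p q r : p \in s -> q \in s -> r \in s -> p != q -> p != r -> q != r -> det3 p q r != 0.
  by move=> *; apply: (irredundant_det3 irr su).
have [s3|s3] := leqP (size s) 3.
  case: s s2 s3 su irr us det {sn} => [//|a [//|b [//|d [|//]]]] _ _ su irr us det.
  exists [:: (a, b, d)]; split.
  - move=> t; rewrite inE => /eqP -> /=; rewrite !inE !eqxx ?orbT; split=> //.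
    move: us; rewrite /= !inE !negb_or => /andP[/andP[ab ad] /andP[bd _]].
    by apply: det; rewrite ?inE ?eqxx ?orbT.
  - move=> x xs; exists (a, b, d); first exact: mem_head.
    apply: cone_sub xs => z /=; rewrite !inE => /or3P[] /eqP; by [left|right;left|right;right].
  - by move=> [|i] [|j].
have [p [q [r [t [ps qs rs ts [pq lr lt]]]]]] : exists p q r t, [/\ p \in s, q \in s, r \in s,
  t \in s &
    [/\ p != q, 0 < det3 p q r & det3 p q t < 0]].
  case: s s3 us det {sn s2 su irr} => [//|p [//|q [//|r [//|t s]]]] _ us det.
  move: us; rewrite /= !inE !negb_or.
  move=> /andP[/and4P[pq pr pt _] /andP[/and3P[qr qt _] /andP[/andP[rt _] _]]].
  have [||| q' [r' [t' [sub lr lt]]]] := @exists_separating p q r t.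
  - by apply: det => //; rewrite !inE eqxx ?orbT.
  - by apply: det => //; rewrite !inE eqxx ?orbT.
  - by apply: det => //; rewrite ?inE ?eqxx ?orbT // eq_sym.
  have sub' z : z \in [:: q'; r'; t'] -> z \in [:: p, q, r, t & s].
    by move=> /sub; rewrite !inE => /or3P[] ->; rewrite ?orbT.
  exists p, q', r', t'; split; rewrite ?mem_head //; try by apply: sub'; rewrite !inE eqxx ?orbT.
  split=> //; apply/eqP => e; move: lr; rewrite e /det3; lra.
pose l := det3 p q.
pose s1 := [seq z <- s | 0 <= l z]; pose s2' := [seq z <- s | l z <= 0].
have lp : l p = 0 by rewrite /l /det3; ring.
have lq : l q = 0 by rewrite /l /det3; ring.
(* Each half keeps [p], [q] and a vertex strictly on its own side, and loses one strictly on the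
   other side. *)
have sz (P : pred V) (x y : V) : x \in s -> ~~ P x -> P p -> P q -> y \in s -> P y -> l y != 0 ->
    (size [seq z <- s | P z] < n)%N /\ (2 < size [seq z <- s | P z])%N.
  move=> xs nPx Pp Pq ys Py ly; split.
    apply: leq_trans sn; rewrite size_filter -(count_predC P s) -addn1 leq_add2l -has_count.
    by apply/hasP; exists x.
  apply: (@uniq_leq_size _ [:: p; q; y]); last first.
    by move=> z; rewrite !inE mem_filter => /or3P[] /eqP ->; rewrite ?Pp ?Pq ?Py.
  rewrite /= !inE negb_or pq /= andbT; apply/andP; split.
    by apply: contraNneq ly => <-; rewrite lp.
  by apply: contraNneq ly => <-; rewrite lq.
have [z1 z1'] : (size s1 < n)%N /\ (2 < size s1)%N.
  by apply: (sz _ t r) => //=; rewrite ?lp ?lq ?lexx ?(ltW lr) ?gt_eqF // -ltNge.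
have [z2 z2'] : (size s2' < n)%N /\ (2 < size s2')%N.
  by apply: (sz _ r t) => //=; rewrite ?lp ?lq ?lexx ?(ltW lt) ?lt_eqF // -ltNge.
have sub1 : {subset s1 <= s} by move=> z; rewrite mem_filter => /andP[].
have sub2 : {subset s2' <= s} by move=> z; rewrite mem_filter => /andP[].
have [|||D1 [D1s D1c D1d]] := ih s1 z1 _ z1'; first by rewrite filter_uniq.
- by move=> v /sub1 /su.
- exact: irredundant_sub irr.
have [|||D2 [D2s D2c D2d]] := ih s2' z2 _ z2'; first by rewrite filter_uniq.
- by move=> v /sub2 /su.
- exact: irredundant_sub irr.
exists (D1 ++ D2); split.
- move=> v; rewrite mem_cat => /orP[/D1s[]|/D2s[]] h1 h2 h3 h4; split=> //.
  + exact: sub1. + exact: sub1. + exact: sub1.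
  + exact: sub2. + exact: sub2. + exact: sub2.
- move=> x /(cone_split irr su ps qs pq)[] Cx.
    have [|v vD vx] := D1c x.
      by apply: cone_sub Cx => z /= [zs lz]; rewrite mem_filter lz zs.
    by exists v => //; rewrite mem_cat vD.
  have [|v vD vx] := D2c x.
    by apply: cone_sub Cx => z /= [zs lz]; rewrite mem_filter lz zs.
  by exists v => //; rewrite mem_cat vD orbT.
apply: disjoint_interiors_cat => // -[[a b] d] [[a' b'] d'] /D1s /= + /D2s /=.
rewrite !mem_filter => -[/andP[la as_] /andP[lb bs] /andP[ld ds] dn].
move=> [/andP[la' as'] /andP[lb' bs'] /andP[ld' ds'] dn'].
have lin x y z (X Y Z : R) : l (X *: x + Y *: y + Z *: z) = X * l x + Y * l y + Z * l z.
  by rewrite /l /det3 !mxE; ring.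
(* A nondegenerate triangle has a vertex off the line, as [s] meets the line only in [p] and [q]. *)
have nz x y z : x \in s -> y \in s -> z \in s -> det3 x y z != 0 ->
   ~ [/\ l x = 0, l y = 0 & l z = 0].
  move=> xs ys zs /eqP n0 [lx ly lz]; apply: n0.
  have M v : v \in s -> l v = 0 -> v = p \/ v = q by apply: (mem_split_line irr su ps qs pq).
  case: (M x xs lx) => ->; case: (M y ys ly) => ->; case: (M z zs lz) => ->; rewrite /det3; ring.
apply/seteqP; split=> // x [[X [Y [Z [X0 [Y0 [Z0 [_ xE]]]]]]] [X' [Y' [Z' [X0' [Y0' [Z0' [_
  xE']]]]]]]].
(* Hence the relative interior of a triangle of the first half lies strictly on the positive side,
   whereas triangles of the second half stay on the nonpositive side. *)
have P1 : 0 < l x.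
  have h1 : 0 <= X * l a by rewrite mulr_ge0 // ltW.
  have h2 : 0 <= Y * l b by rewrite mulr_ge0 // ltW.
  have h3 : 0 <= Z * l d by rewrite mulr_ge0 // ltW.
  rewrite lt_neqAle eq_sym xE lin !addr_ge0 // andbT; apply/eqP => e.
  apply: (nz _ _ _ as_ bs ds dn); split; apply/eqP.
  - by rewrite -(mulrI_eq0 _ (lregP (lt0r_neq0 X0))); apply/eqP; move: h1 h2 h3 e; clear; lra.
  - by rewrite -(mulrI_eq0 _ (lregP (lt0r_neq0 Y0))); apply/eqP; move: h1 h2 h3 e; clear; lra.
  - by rewrite -(mulrI_eq0 _ (lregP (lt0r_neq0 Z0))); apply/eqP; move: h1 h2 h3 e; clear; lra.
suff P2 : l x <= 0 by move: P1; rewrite ltNge P2.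
have h1 : X' * l a' <= 0 by rewrite mulr_ge0_le0 // ltW.
have h2 : Y' * l b' <= 0 by rewrite mulr_ge0_le0 // ltW.
have h3 : Z' * l d' <= 0 by rewrite mulr_ge0_le0 // ltW.
by rewrite xE' lin; move: h1 h2 h3; clear; lra.
Qed.

(** Redundant points are discarded one by one; each lies in the cone of the remaining ones, so the
    cone does not shrink. *)
Lemma irredundant_cone (s : seq V) : exists s' : seq V,
  [/\ uniq s', {subset s' <= s}, irredundant s' & cone [set` s] `<=` cone [set` s']].
Proof.
have [n] := ubnP (size s); elim: n s => // n ih s; rewrite ltnS => sn.
have [irr|] := pselect (irredundant s).
  exists (undup s); split; rewrite ?undup_uniq //.
  - by move=> v; rewrite mem_undup.
  - by apply: irredundant_sub irr => v; rewrite mem_undup.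
  - by apply: cone_sub => v /=; rewrite mem_undup.
move=> /existsNP[v /not_implyP[vs /contrapT Cv]].
pose s0 := [seq x <- s | x != v].
have [|s' [us' ss' irr' Cs']] := ih s0.
  apply: leq_trans sn; rewrite size_filter -(count_predC (fun x =>
    x != v) s) -addn1 leq_add2l -has_count.
  by apply/hasP; exists v => //=; rewrite eqxx.
exists s'; split=> //; first by move=> x /ss'; rewrite mem_filter => /andP[].
move=> x Cx; apply: Cs'; move: x Cx; apply: cone_trans => x xs.
have [->|xv] := eqVneq x v; last by apply: cone_gen; rewrite /= mem_filter xv.
by apply: cone_sub Cv => y /= [ys /eqP yv]; rewrite mem_filter yv.
Qed.

End Triangulation.
End Cones.

(** * Faces of the convex hull *)

Section Topology.
Variable R : realType.
Local Notation V := 'rV[R]_3.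
Local Notation conv := (@Defs.conv R).

Lemma closure_rowP n (S : set 'rV[R]_n) (x : 'rV[R]_n) : closure S x <->
  forall e : R, 0 < e -> exists z : 'rV[R]_n, S z /\ forall i, `|x 0 i - z 0 i| < e.
Proof.
split=> [cl e e0|H B /nbhs_ballP[e e0 eB]].
  have [|z [Sz [_ zb]]] := cl (ball x e); first exact: nbhsx_ballx.
  by exists z; split=> // i; apply: zb.
have [z [Sz zb]] := H e e0; exists z; split=> //; apply: eB; split=> // i j.
by rewrite ord1; apply: zb.
Qed.

Lemma interior_rowP n (S : set 'rV[R]_n) (x : 'rV[R]_n) : interior S x ->
  exists2 e : R, 0 < e & forall z : 'rV[R]_n, (forall i, `|x 0 i - z 0 i| < e) -> S z.
Proof.
move=> /nbhs_ballP[e e0 eB]; exists e => // z zb; apply: eB; split=> // i j.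
by rewrite ord1; apply: zb.
Qed.

(** A continuous image of the compact unit cube. This supplies the closedness of a polytope with
    finitely many generators. *)
Lemma mulmx_box_closed m n (Q : 'M[R]_(m, n)) :
  closed [set w *m Q | w in [set w : 'rV[R]_m | forall i, (`[0, 1]%classic : set R) (w 0 i)]].
Proof.
apply: compact_closed; first exact: norm_hausdorff.
apply: continuous_compact; last exact: (@rV_compact R m (fun=> `[0, 1]%classic : set R) (fun=>
  @segment_compact R 0 1)).
apply: continuous_subspaceT => w B /nbhs_ballP[e /= e0 eB].
(* A Lipschitz constant of the linear map for the sup norm, kept positive by the summand 1. *)
pose C := 1 + \sum_i \sum_j `|Q i j|.
have sC i : 0 <= \sum_j `|Q i j| by apply: sumr_ge0.
have C0 : 0 < C by rewrite ltr_pwDl // sumr_ge0.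
apply/nbhs_ballP; exists (e / C) => /=; first by rewrite divr_gt0.
move=> v [_ wv]; apply: eB; split=> // i j; rewrite ord1 /ball /= !mxE -sumrB.
apply: le_lt_trans (ler_norm_sum _ _ _) _.
apply: le_lt_trans (_ : \sum_k (e / C) * `|Q k j| < _).
  apply: ler_sum => k _; rewrite -mulrBl normrM ler_wpM2r //; apply/ltW; exact: (wv 0 k).
rewrite -mulr_sumr -mulrA [_^-1 * _]mulrC mulrA ltr_pdivrMr // ltr_pM2l //.
rewrite /C ltr_pwDl // ler_sum // => k _.
by rewrite (bigD1 j) //= lerDl sumr_ge0.
Qed.

Lemma conv_gen (S : set V) x : S x -> conv S x.
Proof.
move=> Sx; exists 1%N, (fun=> x), (fun=> 1); split=> //; split=> //.
by rewrite !big_ord1 scale1r.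
Qed.

Lemma conv_halfspace (S : set V) (v : V) e x :
  (forall p, S p -> e <= dotv v p) -> conv S x -> e <= dotv v x.
Proof.
move=> Se [n [p [w [Sp [w0 [w1 ->]]]]]]; rewrite dotv_sum -[e]mul1r -w1 mulr_suml.
by apply: ler_sum => i _; rewrite dotvZ ler_wpM2l // Se.
Qed.

Lemma closure_conv_halfspace (S : set V) (v : V) e (x : V) :
  (forall p, S p -> e <= dotv v p) -> closure (conv S) x -> e <= dotv v x.
Proof.
move=> Se /closure_rowP cl; rewrite leNgt; apply/negP => h.
pose C := 1 + `|v 0 0| + `|v 0 1| + `|v 0 2%:R|.
have C0 : 0 < C by rewrite /C; have := normr_ge0 (v 0 0); have := normr_ge0 (v 0 1);
  have := normr_ge0 (v 0 2%:R); lra.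
(* Within distance [d] of [x] the form [v] varies by less than [e - dotv v x]. *)
pose d := (e - dotv v x) / C.
have d0 : 0 < d by rewrite divr_gt0 // subr_gt0.
have dE : d * C = e - dotv v x by rewrite /d divfK // gt_eqF.
have [z [Sz zx]] := cl d d0.
have ez := conv_halfspace Se Sz.
have key i : v 0 i * (z 0 i - x 0 i) <= `|v 0 i| * d.
  apply: le_trans (ler_norm _) _; rewrite normrM ler_wpM2l // distrC; exact: ltW.
have := key 0; have := key 1; have := key 2%:R; move: dE ez d0; rewrite !dotvE /C; clear; lra.
Qed.

End Topology.

(** * The supporting plane of a face and the lattice points on it *)

Section Face.
Variable R : realType.
Local Notation V := 'rV[R]_3.
Local Notation conv := (@Defs.conv R).
Variable L : set V.
Hypothesis Lfin : forall B : R, finite_set [set v : V | L v /\ forall i, `|v 0 i| <= B].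
Hypothesis Lnorm : forall v : V, L v -> posorth v -> 1 <= v 0 0 * v 0 1 * v 0 2%:R.
Hypothesis Lsmall : forall (i : 'I_3) (eps : R), 0 < eps ->
  exists v : V, [/\ L v, posorth v & forall j, j != i -> v 0 j < eps].

Let P := L `&` @posorth R.

(* If [a b d >= 1], then [a < s^2], [s b < 1] and [s d < 1] cannot all hold. *)
Let weighted_sum_ge (a b d s : R) : 0 < a -> 0 < b -> 0 < d -> 1 <= a * b * d -> 0 < s ->
  s ^+ 2 <= a + s ^+ 3 * (b + d).
Proof.
move=> a0 b0 d0 n1 s0; rewrite leNgt; apply/negP => h.
have s2 : 0 < s ^+ 2 by rewrite exprn_gt0.
have s3 : 0 < s ^+ 3 by rewrite exprn_gt0.
have h1 : a < s ^+ 2 by have := mulr_gt0 s3 (addr_gt0 b0 d0); lra.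
have h2 : s * b < 1.
  rewrite -(ltr_pM2l s2) mulr1; have -> : s ^+ 2 * (s * b) = s ^+ 3 * b by ring.
  by have := mulr_gt0 s3 d0; lra.
have h3 : s * d < 1.
  rewrite -(ltr_pM2l s2) mulr1; have -> : s ^+ 2 * (s * d) = s ^+ 3 * d by ring.
  by have := mulr_gt0 s3 b0; lra.
have h4 : a * (s * b * (s * d)) < s ^+ 2 * 1.
  have sb := mulr_gt0 s0 b0; have sd := mulr_gt0 s0 d0.
  apply: ltr_pM => //; first exact: ltW.
    by rewrite mulr_ge0 // ltW.
  by have := ltr_pM (ltW sb) (ltW sd) h2 h3; rewrite mulr1.
have : s ^+ 2 * (a * b * d) < s ^+ 2 * 1.
  by apply: le_lt_trans h4; rewrite le_eqVlt; apply/orP; left; apply/eqP; ring.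
by rewrite ltr_pM2l // ltNge n1.
Qed.

(** If [a <= 0], the choice [s = 1 / (b + d + 1)] violates the inequality, since then
    [s (b + d) < 1]. *)
Let pos_of_weighted (a b d : R) : 0 <= b -> 0 <= d ->
  (forall s, 0 < s -> s ^+ 2 <= a + s ^+ 3 * (b + d)) -> 0 < a.
Proof.
move=> b0 d0 H; rewrite ltNge; apply/negP => a0.
pose s := (b + d + 1)^-1.
have bd : 0 < b + d + 1 by lra.
have s0 : 0 < s by rewrite invr_gt0.
have s2 : 0 < s ^+ 2 by rewrite exprn_gt0.
have h := H s s0.
have : s ^+ 2 * 1 <= s ^+ 2 * (s * (b + d)).
  have -> : s ^+ 2 * (s * (b + d)) = s ^+ 3 * (b + d) by ring.
  by rewrite mulr1; lra.
rewrite ler_pM2l // /s mulrC ler_pdivlMr //; lra.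
Qed.

(** Positivity is an open condition and need not survive a limit. The linear inequalities with
    parameter [s], valid at lattice points by the norm bound, do survive, and together they force
    positive coordinates. *)
Lemma closure_hull_posorth (x : V) : closure (conv P) x -> posorth x.
Proof.
move=> cx.
have ge0 i : 0 <= x 0 i.
  have -> : x 0 i = dotv (delta_mx 0 i) x by rewrite /dotv -rowE !mxE.
  apply: closure_conv_halfspace cx => p [_ pp].
  by rewrite /dotv -rowE !mxE ltW.
have wt a b d s : 0 < s -> (forall p, P p -> s ^+ 2 <= dotv (row3 a b d) p) ->
    s ^+ 2 <= dotv (row3 a b d) x by move=> _ h; apply: closure_conv_halfspace cx.
apply: ord3P.
- apply: (pos_of_weighted (ge0 1) (ge0 2%:R)) => s s0.
  have -> : x 0 0 + s ^+ 3 * (x 0 1 + x 0 2%:R) = dotv (row3 1 (s ^+ 3) (s ^+ 3)) x.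
    by rewrite dotvE !mxE /=; ring.
  apply: wt => // p [Lp pp].
  have -> : dotv (row3 1 (s ^+ 3) (s ^+ 3)) p = p 0 0 + s ^+ 3 * (p 0 1 + p 0 2%:R).
    by rewrite dotvE !mxE /=; ring.
  by apply: weighted_sum_ge => //; apply: Lnorm.
- apply: (pos_of_weighted (ge0 0) (ge0 2%:R)) => s s0.
  have -> : x 0 1 + s ^+ 3 * (x 0 0 + x 0 2%:R) = dotv (row3 (s ^+ 3) 1 (s ^+ 3)) x.
    by rewrite dotvE !mxE /=; ring.
  apply: wt => // p [Lp pp].
  have -> : dotv (row3 (s ^+ 3) 1 (s ^+ 3)) p = p 0 1 + s ^+ 3 * (p 0 0 + p 0 2%:R).
    by rewrite dotvE !mxE /=; ring.
  by apply: weighted_sum_ge => //; rewrite [p 0 1 * _]mulrC; apply: Lnorm.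
- apply: (pos_of_weighted (ge0 0) (ge0 1)) => s s0.
  have -> : x 0 2%:R + s ^+ 3 * (x 0 0 + x 0 1) = dotv (row3 (s ^+ 3) (s ^+ 3) 1) x.
    by rewrite dotvE !mxE /=; ring.
  apply: wt => // p [Lp pp].
  have -> : dotv (row3 (s ^+ 3) (s ^+ 3) 1) p = p 0 2%:R + s ^+ 3 * (p 0 0 + p 0 1).
    by rewrite dotvE !mxE /=; ring.
  by apply: weighted_sum_ge => //; rewrite -mulrA mulrC; apply: Lnorm.
Qed.

Variables (u : V) (c : R).
Hypothesis u0 : u != 0.
Hypothesis supp : forall x, conv P x -> c <= dotv u x.

Let suppP p : P p -> c <= dotv u p.
Proof. by move=> Pp; apply/supp/conv_gen. Qed.

Let dotv_bound i p eps : 0 < eps -> posorth p -> (forall j, j != i -> p 0 j < eps) ->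
  dotv u p <= u 0 i * p 0 i + eps * \sum_j `|u 0 j|.
Proof.
move=> e0 pp pe; have -> : dotv u p = \sum_j u 0 j * p 0 j by rewrite dotvE sum3.
rewrite [in X in X <= _](bigD1 i) //= lerD2l mulr_sumr [X in _ <= X](bigD1 i) //=.
rewrite ler_wpDl ?mulr_ge0 ?(ltW e0) //; apply: ler_sum => j ji.
apply: le_trans (ler_norm _) _; rewrite normrM mulrC ler_wpM2r //.
by rewrite gtr0_norm // ltW // pe.
Qed.

(** The product of the coordinates is at least 1, while that of the two small ones is below
    [eps]. *)
Let small_large i eps (p : V) : 0 < eps -> eps <= 1 -> P p -> (forall j, j != i -> p 0 j < eps) ->
  1 < p 0 i * eps.
Proof.
move=> e0 e1 [Lp pp] pe; have := Lnorm Lp pp.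
have key (a b d : R) : 0 < a -> 0 < b -> 0 < d -> b < eps -> d < eps -> 1 <= a * b * d ->
  1 < a * eps.
  move=> a0 b0 d0 be de h; apply: le_lt_trans h _; rewrite -mulrA ltr_pM2l //.
  by rewrite -[X in _ < X]mulr1 ltr_pM // ?(ltW b0) ?(ltW d0) // (lt_le_trans de).
move: i pe; apply: ord3P => pe h.
- by apply: (key _ (p 0 1) (p 0 2%:R)); rewrite ?pe.
- by apply: (key _ (p 0 0) (p 0 2%:R)); rewrite ?pe // [p 0 1 * _]mulrC.
- by apply: (key _ (p 0 0) (p 0 1)); rewrite ?pe // -mulrA mulrC.
Qed.

Section Positive.
Variable x0 : V.
Hypotheses (clx0 : closure (conv P) x0) (ux0 : dotv u x0 = c).

(** If [u 0 i] were negative, lattice points far out along the i-th axis and close to it would fall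
    below height [c]. *)
Let u_ge0 i : 0 <= u 0 i.
Proof.
rewrite leNgt; apply/negP => ui.
pose S := \sum_j `|u 0 j|; pose B := `|(S - c) / (- u 0 i)| + 1.
have S0 : 0 <= S by apply: sumr_ge0.
have B0 : 1 <= B by rewrite lerDr.
have B1 : 0 < B by lra.
have [|p [Lp pp pe]] := @Lsmall i B^-1; first by rewrite invr_gt0.
have Bi : 0 < B^-1 by rewrite invr_gt0.
have Bi1 : B^-1 <= 1 by rewrite invf_le1.
have := small_large Bi Bi1 (conj Lp pp) pe; rewrite ltr_pdivlMr // mul1r => pB.
have := dotv_bound Bi pp pe; have := suppP (conj Lp pp) => h1 h2.
have h3 : B^-1 * S <= S by rewrite ler_piMl.
have : p 0 i <= (S - c) / (- u 0 i).
  rewrite ler_pdivlMr ?oppr_gt0 //; move: h1 h2 h3; rewrite -/S; lra.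
have := ler_norm ((S - c) / (- u 0 i)); move: pB; rewrite /B; lra.
Qed.

(** If [u 0 i = 0], lattice points close to the i-th axis have arbitrarily small height, so
    [c <= 0]. But [u] is nonnegative and [x0] has positive coordinates, so height [c] at [x0] would
    give [u = 0]. *)
Lemma face_normal_pos i : 0 < u 0 i.
Proof.
rewrite lt_neqAle eq_sym u_ge0 andbT; apply/eqP => ui.
pose S := \sum_j `|u 0 j|.
have S0 : 0 <= S by apply: sumr_ge0.
have c_le0 : c <= 0.
  rewrite leNgt; apply/negP => c0.
  have e0 : 0 < c / (S + 1) by rewrite divr_gt0 //; lra.
  have [p [Lp pp pe]] := Lsmall i e0.
  have := dotv_bound e0 pp pe; have := suppP (conj Lp pp) => h1; rewrite ui mul0r add0r -/S => h2.
  have : c / (S + 1) * S < c by rewrite -mulrA [_^-1 * _]mulrC mulrA ltr_pdivrMr ?ltr_pM2l //;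
    lra.
  by lra.
have xp := closure_hull_posorth clx0.
have t_ge0 j : 0 <= u 0 j * x0 0 j by rewrite mulr_ge0 // ltW.
move: ux0; rewrite dotvE => e; have h0 := t_ge0 0; have h1 := t_ge0 1; have h2 := t_ge0 2%:R.
have z j : u 0 j * x0 0 j = 0 -> u 0 j = 0 by move=> /eqP;
  rewrite mulf_eq0 (gt_eqF (xp j)) orbF => /eqP.
move/eqP: u0; apply; apply/rowP; apply: ord3P; rewrite mxE; apply: z; lra.
Qed.

Lemma face_level_pos : 0 < c.
Proof.
have xp := closure_hull_posorth clx0; have up := face_normal_pos.
by rewrite -ux0 dotvE !addr_gt0 // mulr_gt0.
Qed.

(** All entries of [u] are positive, so a bound on the height bounds every coordinate. *)
Lemma slab_finite (M : R) : finite_set [set p | P p /\ dotv u p <= M].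
Proof.
pose B := `|M| * (1 / u 0 0 + 1 / u 0 1 + 1 / u 0 2%:R).
apply: sub_finite_set (Lfin B) => p [[Lp pp] pM]; split=> // i.
have up := face_normal_pos.
have iv j : 0 < 1 / u 0 j by rewrite divr_gt0.
have pu : u 0 i * p 0 i <= `|M|.
  apply: le_trans (_ : dotv u p <= _); last by rewrite (le_trans pM) // ler_norm.
  have t j : 0 < u 0 j * p 0 j by rewrite mulr_gt0.
  have t0 := t 0; have t1 := t 1; have t2 := t 2%:R.
  by rewrite dotvE; move: (i); apply: ord3P; lra.
rewrite gtr0_norm //; apply: le_trans (_ : `|M| * (1 / u 0 i) <= _).
  by rewrite mulrA mulr1 ler_pdivlMr // mulrC.
rewrite ler_wpM2l //; have i0 := iv 0; have i1 := iv 1; have i2 := iv 2%:R.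
by move: (i); apply: ord3P; lra.
Qed.

Lemma face_points : exists f : seq V, forall v, v \in f <-> P v /\ dotv u v = c.
Proof.
have /finite_seqP[f fE] : finite_set [set p | P p /\ dotv u p = c].
  by apply: sub_finite_set (slab_finite c) => p [Pp e]; split; rewrite ?e.
by exists f => v; have := congr1 (fun A : set V => A v) fE; rewrite /= => ->.
Qed.

Let seq_gap (r : seq R) : exists2 h : R, 0 < h & forall y, y \in r -> y <= 0 \/ h <= y.
Proof.
elim: r => [|y r [h h0 hr]]; first by exists 1.
have [y0|y0] := lerP y 0.
  by exists h => // z; rewrite inE => /orP[/eqP ->|/hr]; [left|].
exists (Num.min h y); first by rewrite lt_min h0.
move=> z; rewrite inE => /orP[/eqP ->|/hr[z0|hz]]; [right|by left|right].
  by rewrite ge_min lexx orbT.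
by rewrite ge_min hz.
Qed.

(** Only finitely many heights occur up to [c + 1]. *)
Lemma face_gap : exists2 h : R, 0 < h & forall p, P p -> dotv u p = c \/ c + h <= dotv u p.
Proof.
have /finite_seqP[f fE] := slab_finite (c + 1).
have [h h0 hr] := seq_gap [seq dotv u p - c | p <- f].
exists (Num.min h 1); first by rewrite lt_min h0 ltr01.
move=> p Pp; have [h1|h1] := lerP (dotv u p) (c + 1); last first.
  by right; rewrite (le_trans _ (ltW h1)) // lerD2l ge_min lexx orbT.
have pf : p \in f by have := congr1 (fun A : set V => A p) fE; rewrite /= => <-.
have := suppP Pp; case: (hr (dotv u p - c)); first by apply/mapP; exists p.
  by move=> ? ?; left; lra.
by move=> hp _; right; rewrite -lerBrDl (le_trans _ hp) // ge_min lexx.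
Qed.

(** Otherwise the gap would lift the whole closed hull to height [c + h], although [x0] has height
    [c]. *)
Let face_nonempty : exists p, P p /\ dotv u p = c.
Proof.
have [h h0 hP] := face_gap; apply: contrapT => ne.
have : c + h <= dotv u x0.
  apply: closure_conv_halfspace clx0 => p Pp; case: (hP p Pp) => // e.
  by exfalso; apply: ne; exists p.
by rewrite ux0; lra.
Qed.

(* The distance to the face is bounded by a multiple of the height above its plane: this
   condition is preserved under convex combinations and holds at lattice points by the gap. *)
Let hull_near_face : exists2 C : R, 0 <= C & forall z, conv P z ->
  exists2 y, cone [set v | P v /\ dotv u v = c] y /\ dotv u y = c &
    forall k, `|z 0 k - y 0 k| <= C * (dotv u z - c).
Proof.
have [h h0 hP] := face_gap; have [y0 [Py0 uy0]] := face_nonempty.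
have up := face_normal_pos; have c0 := face_level_pos.
(* A lattice point [p] off the plane is compared with the fixed point [y0]: [p 0 k] is at most
   [dotv u p / u 0 k], and the constant terms are absorbed by [1 <= (dotv u p - c) / h]. *)
pose B k := 1 / u 0 k + (c / u 0 k + y0 0 k) / h.
have B0 k : 0 <= B k.
  have y0k : 0 < y0 0 k by case: Py0.
  have i0 := up k; rewrite /B addr_ge0 //; first by rewrite divr_ge0 // ltW.
  by rewrite divr_ge0 ?(ltW h0) // addr_ge0 ?(ltW y0k) // divr_ge0 // ltW.
exists (B 0 + B 1 + B 2%:R); first by do 2?[apply: addr_ge0 => //].
have BC k : B k <= B 0 + B 1 + B 2%:R.
  by have b0 := B0 0; have b1 := B0 1; have b2 := B0 2%:R; move: k; apply: ord3P; lra.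
move=> z [n [p [w [Pp [w0 [w1 ->]]]]]].
have /choice[y yP] i : exists y, (cone [set v | P v /\ dotv u v = c] y /\ dotv u y = c) /\
    forall k, `|p i 0 k - y 0 k| <= (B 0 + B 1 + B 2%:R) * (dotv u (p i) - c).
  case: (hP _ (Pp i)) => [e|e].
    exists (p i); split; first by split=> //; apply: cone_gen; split=> //; apply: Pp.
    by move=> k; rewrite subrr normr0 e subrr mulr0.
  exists y0; split; first by split=> //; apply: cone_gen; split.
  move=> k; apply: le_trans (_ : B k * (dotv u (p i) - c) <= _); last first.
    by rewrite ler_wpM2r // subr_ge0 suppP.
  have [_ pp] := Pp i; have [_ yp] := Py0.
  have pk : p i 0 k <= dotv u (p i) / u 0 k.
    rewrite ler_pdivlMr // mulrC; have t j : 0 < u 0 j * p i 0 j by rewrite mulr_gt0.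
    have t0 := t 0; have t1 := t 1; have t2 := t 2%:R.
    by rewrite dotvE; move: (k); apply: ord3P; lra.
  apply: le_trans (_ : p i 0 k + y0 0 k <= _).
    by rewrite ler_norml; apply/andP; split; have := pp k; have := yp k; lra.
  apply: le_trans (_ : dotv u (p i) / u 0 k + y0 0 k <= _); first by rewrite lerD2r.
  have -> : dotv u (p i) / u 0 k + y0 0 k = (dotv u (p i) - c) / u 0 k + (c / u 0 k + y0 0 k) * 1.
    by field; rewrite gt_eqF.
  have -> : B k * (dotv u (p i) - c) = (dotv u (p i) - c) / u 0 k
      + (c / u 0 k + y0 0 k) * ((dotv u (p i) - c) / h).
    by rewrite /B; field; rewrite !gt_eqF.
  rewrite lerD2l ler_wpM2l ?ler_pdivlMr ?mul1r //; last by lra.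
  by rewrite addr_ge0 ?divr_ge0 // ltW.
exists (\sum_i w i *: y i).
  split.
    apply: big_ind => [|a b|i _]; [exact: cone0|exact: cone_add|].
    by apply: cone_scale => //; case: (yP i) => [[]].
  rewrite dotv_sum (eq_bigr (fun i => w i * c)); last by move=> i _; rewrite dotvZ (yP i).1.2.
  by rewrite -mulr_suml w1 mul1r.
move=> k; rewrite !summxE -sumrB; apply: le_trans (ler_norm_sum _ _ _) _.
have -> : dotv u (\sum_i w i *: p i) - c = \sum_i w i * (dotv u (p i) - c).
  rewrite dotv_sum -[c in LHS]mul1r -w1 mulr_suml -sumrB; apply: eq_bigr => i _.
  by rewrite dotvZ mulrBr.
rewrite mulr_sumr; apply: ler_sum => i _; rewrite !mxE -mulrBr normrM ger0_norm // mulrCA.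
by rewrite ler_wpM2l // (yP i).2.
Qed.

(** [x] is a limit of hull points whose heights tend to [c]. These come arbitrarily close to the
    polytope of the finitely many lattice points of height [c], which lies in a closed subset of the
    cone. *)
Lemma face_cone (x : V) : closure (conv P) x -> dotv u x = c ->
  cone [set v | P v /\ dotv u v = c] x.
Proof.
move=> /closure_rowP clx ux.
have [C C0 near] := hull_near_face; have c0 := face_level_pos.
have [f fE] := face_points.
pose Q : 'M[R]_(size f, 3) := \matrix_(i < size f) f`_i.
have mulQ (w : 'rV_(size f)) : w *m Q = \sum_i w 0 i *: f`_i.
  by rewrite mulmx_sum_row; apply: eq_bigr => i _; rewrite rowK.
(* At height [c] the weights sum to 1, so they lie in the unit cube. *)
have box y : cone [set v | P v /\ dotv u v = c] y -> dotv u y = c ->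
    [set w *m Q | w in [set w : 'rV[R]_(size f) | forall i, (`[0, 1]%classic : set R) (w 0 i)]] y.
  move=> Cy uy.
  have [w w0 yE] : exists2 w : 'rV[R]_(size f), (forall i, 0 <= w 0 i) & y = w *m Q.
    move: Cy {uy}; elim=> [|k p z k0 Pp _ [w w0 ->]].
      by exists 0 => [i|]; rewrite ?mxE ?mul0mx.
    have pf : (index p f < size f)%N by rewrite index_mem; apply/fE.
    exists (k *: delta_mx 0 (Ordinal pf) + w) => [i|].
      by rewrite !mxE addr_ge0 // mulr_ge0.
    rewrite mulmxDl -scalemxAl -rowE rowK /= nth_index //; exact/fE.
  exists w => // i; rewrite /= in_itv /= w0 /=.
  have : \sum_i w 0 i = 1.
    apply: (mulIf (lt0r_neq0 c0)); rewrite mul1r -{2}uy yE mulQ dotv_sum mulr_suml.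
    apply: eq_bigr => j _; rewrite dotvZ; congr (_ * _).
    by have /fE[_ ->] : f`_j \in f by rewrite mem_nth.
  by move=> <-; rewrite (bigD1 i) //= lerDl sumr_ge0.
have : closure [set w *m Q | w in [set w : 'rV[R]_(size f) | forall i, (`[0,
  1]%classic : set R) (w 0 i)]] x.
  apply/closure_rowP => e e0.
  pose S := 1 + `|u 0 0| + `|u 0 1| + `|u 0 2%:R|.
  have n0 := normr_ge0 (u 0 0); have n1 := normr_ge0 (u 0 1); have n2 := normr_ge0 (u 0 2%:R).
  have S0 : 0 < S by rewrite /S; lra.
  have D0 : 0 < 1 + C * S by rewrite ltr_pwDl // mulr_ge0 // ltW.
  (* Chosen so that the distance [d] from [x] to [z] and the distance [C S d] from [z] to [y] add up
     to [e]. *)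
  pose d := e / (1 + C * S).
  have d0 : 0 < d by rewrite divr_gt0.
  have [z [Pz zx]] := clx d d0.
  have [y [Cy uy] yz] := near z Pz.
  exists y; split; first exact: box.
  move=> i; have uz : dotv u z - c <= S * d.
    have t j : u 0 j * (z 0 j - x 0 j) <= `|u 0 j| * d.
      apply: le_trans (ler_norm _) _; rewrite normrM ler_wpM2l // distrC; exact: ltW.
    have t0 := t 0; have t1 := t 1; have t2 := t 2%:R.
    by rewrite -ux !dotvE /S; lra.
  have -> : x 0 i - y 0 i = (x 0 i - z 0 i) + (z 0 i - y 0 i) by ring.
  apply: le_lt_trans (ler_normD _ _) _.
  have -> : e = d + C * (S * d) by rewrite /d; field; rewrite gt_eqF.
  rewrite ltr_leD ?zx //; apply: le_trans (yz i) _; exact: ler_wpM2l.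
move/closure_id: (@mulmx_box_closed _ _ _ Q) => <- [w wb <-].
rewrite mulQ; apply: big_ind => [|a b|i _]; [exact: cone0|exact: cone_add|].
apply: cone_scale; first by have := wb i; rewrite /= in_itv /= => /andP[].
by apply: cone_gen; apply/fE; rewrite mem_nth.
Qed.

End Positive.

(** A small step along [- u] would stay in the hull and yet go below height [c]. *)
Lemma face_not_interior (x : V) : dotv u x = c -> ~ interior (conv P) x.
Proof.
move=> ux /interior_rowP[e e0 eP].
pose S := 1 + `|u 0 0| + `|u 0 1| + `|u 0 2%:R|.
have n0 := normr_ge0 (u 0 0); have n1 := normr_ge0 (u 0 1); have n2 := normr_ge0 (u 0 2%:R).
have S0 : 0 < S by rewrite /S; lra.
have k0 : 0 < e / S by rewrite divr_gt0.
have /supp : conv P (x - (e / S) *: u).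
  apply: eP => i; rewrite !mxE opprB addrC subrK normrM gtr0_norm //.
  rewrite -mulrA [_^-1 * _]mulrC mulrA ltr_pdivrMr // ltr_pM2l //.
  by move: i; apply: ord3P; rewrite /S; lra.
have uu : 0 < dotv u u.
  rewrite dotvE -!expr2; have s0 := sqr_ge0 (u 0 0); have s1 := sqr_ge0 (u 0 1).
  have s2 := sqr_ge0 (u 0 2%:R).
  rewrite lt_neqAle !addr_ge0 // andbT eq_sym; apply/eqP => uu0.
  have z j : u 0 j ^+ 2 = 0 -> u 0 j = 0 by move=> /eqP; rewrite expf_eq0 => /eqP.
  by move/eqP: u0; apply; apply/rowP; apply: ord3P; rewrite mxE; apply: z; lra.
rewrite dotvB dotvZ ux; have := mulr_gt0 k0 uu; lra.
Qed.

End Face.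

(** * Lattice points over a triangle *)

Section SubClosed.
Variables (U : zmodType) (S : set U).
Hypothesis Ssub : forall v w, S v -> S w -> S (v - w).

Lemma sub_closed0 v : S v -> S 0.
Proof. by move=> Sv; rewrite -(subrr v); apply: Ssub. Qed.

Lemma sub_closedD v w : S v -> S w -> S (v + w).
Proof.
move=> Sv Sw; rewrite -[w]opprK; apply: Ssub => //.
by rewrite -sub0r; apply: Ssub => //; apply: sub_closed0 Sv.
Qed.

Lemma sub_closedMz v (z : int) : S v -> S (v *~ z).
Proof.
move=> Sv; have S0 := sub_closed0 Sv.
have SMn n : S (v *+ n) by elim: n => [|n ih]; rewrite ?mulrS //; apply: sub_closedD.
by case: z => n; [exact: SMn|rewrite NegzE mulrNz -sub0r; apply: Ssub => //; exact: SMn].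
Qed.

End SubClosed.

(** * Coset representatives and indices *)

Section Index.
Variable R : realType.
Local Notation V := 'rV[R]_3.
Variables (G H : set V).
Hypothesis H0 : H 0.
Hypothesis Hsub : forall x y, H x -> H y -> H (x - y).

(** From a finite list meeting every coset, keep one element per coset. *)
Lemma exists_index (X : seq V) : (forall x, x \in X -> G x) ->
  (forall g, G g -> exists2 x, x \in X & H (g - x)) -> exists n, is_index G H n.
Proof.
move=> XG cover.
have [s [sX sep sc]] : exists s : seq V, [/\ {subset s <= X},
    forall i j, (i < size s)%N -> (j < size s)%N -> i != j -> ~ H (s`_i - s`_j)
    & forall x, x \in X -> exists2 y, y \in s & H (x - y)].
  elim: X {XG cover} => [|x X [s [sX sep sc]]]; first by exists [::].
  have [[y ys xy]|nx] := pselect (exists2 y, y \in s & H (x - y)).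
    exists s; split=> //; first by move=> z /sX; rewrite inE orbC => ->.
    by move=> z; rewrite inE => /orP[/eqP ->|/sc //]; exists y.
  exists (x :: s); split.
  - by move=> z; rewrite !inE => /orP[->//|/sX ->]; rewrite orbT.
  - have nx' k : (k < size s)%N -> ~ H (x - s`_k).
      by move=> ks h; apply: nx; exists s`_k; rewrite ?mem_nth.
    move=> [|i] [|j] //=; rewrite ?ltnS ?eqSS; [by move=> _ /nx'| |exact: sep].
    move=> /nx' h _ _; apply: contra_not h => h.
    by rewrite -opprB -[- _]sub0r; apply: Hsub.
  - move=> z; rewrite inE => /orP[/eqP ->|/sc[y ys zy]].
      by exists x; rewrite ?mem_head // subrr.
    by exists y; rewrite // inE ys orbT.
exists (size s), s; split=> //; split; first by move=> x /sX /XG.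
split=> // g /cover[x /sc[y ys xy] gx]; exists (index y s); rewrite index_mem nth_index //.
split=> //; rewrite (_ : g - y = (g - x) - (0 - (x - y))); last by apply/rowP => k;
  rewrite !mxE; ring.
by apply: Hsub => //; apply: Hsub.
Qed.

Lemma is_indexP n : is_index G H n -> exists s : seq V,
  [/\ uniq s, size s = n, forall x, x \in s -> G x,
      forall x y, x \in s -> y \in s -> H (x - y) -> x = y
    & forall g, G g -> exists2 x, x \in s & H (g - x)].
Proof.
move=> [s [sz [sG [sep cov]]]]; rewrite -sz in sep cov.
have inj x y : x \in s -> y \in s -> H (x - y) -> x = y.
  move=> xs ys h; have [e|e] := eqVneq (index x s) (index y s).
    by rewrite -(nth_index 0 xs) -(nth_index 0 ys) e.
  by have := sep _ _ _ _ e; rewrite !index_mem !nth_index // => /(_ xs ys).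
exists s; split=> //.
- apply/(uniqP 0) => i j /= si sj e; apply/eqP/negPn/negP => ij.
  by apply: (sep i j si sj ij); rewrite e subrr.
- by move=> g /cov[i [si h]]; exists s`_i; rewrite ?mem_nth.
Qed.

(** [lat_index] is an arbitrary choice among the numbers that qualify, so it is meaningful as soon
    as one of them is exhibited. *)
Lemma lat_indexP n : is_index G H n -> is_index G H (lat_index G H).
Proof. by move=> h; apply: (Stdlib.Logic.ClassicalEpsilon.epsilon_spec _ _ (ex_intro _ n h)). Qed.

End Index.

Lemma seq_argmin (R : realType) (T : eqType) (f : T -> R) (s : seq T) x : x \in s ->
  exists2 y, y \in s & forall z, z \in s -> f y <= f z.
Proof.
elim: s x => // x [|y s] ih _ _.
  by exists x; rewrite ?mem_head // => z; rewrite inE => /eqP ->.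
have [z zs zm] := ih y (mem_head _ _).
have [h|h] := lerP (f x) (f z).
  exists x; rewrite ?mem_head // => t; rewrite inE => /orP[/eqP -> //|/zm].
  exact: le_trans.
exists z; first by rewrite inE zs orbT.
by move=> t; rewrite inE => /orP[/eqP ->|/zm //]; exact: ltW.
Qed.

(** * Indecomposables in the cone over a lattice triangle *)

Section Count.
Variable R : realType.
Local Notation V := 'rV[R]_3.
Variable L : set V.
Hypothesis Lsub : forall v w : V, L v -> L w -> L (v - w).
Hypothesis Lfin : forall B : R, finite_set [set v : V | L v /\ forall i, `|v 0 i| <= B].
Variables (u : V) (c : R).
Hypothesis c0 : 0 < c.
Let P := L `&` @posorth R.
Hypothesis supp : forall p, P p -> c <= dotv u p.
Variable f : seq V.
Hypothesis fP : forall v, v \in f <-> P v /\ dotv u v = c.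

Definition indec (S : set V) (v : V) :=
  S v /\ ~ exists p q, S p /\ S q /\ v = p + q.

Lemma indec_below v : P v -> dotv u v < 2 * c -> indec P v.
Proof.
move=> Pv h; split=> // -[p [q [/supp Pp [/supp Pq e]]]].
by move: h; rewrite e dotvD; lra.
Qed.

(** This turns out to be the group generated by the lattice points in the plane of the face, so that
    its index in [L] is [ID]. *)
Definition levelZ : set V := [set x | L x /\ exists z : int, dotv u x = z%:~R * c].

Section Triangle.
Variables a b d : V.
Hypotheses (af : a \in f) (bf : b \in f) (df : d \in f).
Hypothesis det : det3 a b d != 0.

Let comb x y z : V := x *: a + y *: b + z *: d.

Let Pa : P a. Proof. by have [] := (fP a).1 af. Qed.
Let Pb : P b. Proof. by have [] := (fP b).1 bf. Qed.
Let Pd : P d. Proof. by have [] := (fP d).1 df. Qed.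
Let ua : dotv u a = c. Proof. by have [] := (fP a).1 af. Qed.
Let ub : dotv u b = c. Proof. by have [] := (fP b).1 bf. Qed.
Let ud : dotv u d = c. Proof. by have [] := (fP d).1 df. Qed.

Let LD v w : L v -> L w -> L (v + w). Proof. exact: sub_closedD. Qed.

Lemma dotv_comb x y z : dotv u (comb x y z) = (x + y + z) * c.
Proof. by rewrite /comb !dotvD !dotvZ ua ub ud; ring. Qed.

Lemma posorth_comb x y z : 0 <= x -> 0 <= y -> 0 <= z -> 0 < x + y + z -> posorth (comb x y z).
Proof.
move=> x0 y0 z0 s0 i; rewrite !mxE.
have [_ /(_ i) a0] := Pa; have [_ /(_ i) b0] := Pb; have [_ /(_ i) d0] := Pd.
have h1 := mulr_ge0 x0 (ltW a0); have h2 := mulr_ge0 y0 (ltW b0); have h3 := mulr_ge0 z0 (ltW d0).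
rewrite lt_neqAle !addr_ge0 // andbT eq_sym; apply/eqP => e.
have z1 (k m : R) : 0 < m -> k * m = 0 -> k = 0.
  by move=> m0 /eqP; rewrite mulf_eq0 (gt_eqF m0) orbF => /eqP.
have hx : x = 0 by apply: (z1 _ _ a0); lra.
have hy : y = 0 by apply: (z1 _ _ b0); lra.
have hz : z = 0 by apply: (z1 _ _ d0); lra.
by move: s0; rewrite hx hy hz !addr0 ltxx.
Qed.

Definition tri_coord (i : 'I_3) (v : V) : R := (v *m invmx (rows3 a b d)) 0 i.

Lemma tri_coordK v : comb (tri_coord 0 v) (tri_coord 1 v) (tri_coord 2%:R v) = v.
Proof. by rewrite /comb -mul_rows3 mulmxKV // rows3_unit. Qed.

Lemma tri_coord_comb x y z i : tri_coord i (comb x y z) = row3 x y z 0 i.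
Proof. by rewrite /tri_coord /comb -mul_row3 mulmxK // rows3_unit. Qed.

Lemma tri_coordB i v w : tri_coord i (v - w) = tri_coord i v - tri_coord i w.
Proof. by rewrite /tri_coord mulmxBl !mxE. Qed.

(* Reflecting through the centre of the parallelepiped (or of one of its facets) exchanges
   heights [h] and [3 - h] (or [2 - h]); a positive lattice point has height at least [1]. *)
Lemma parallelepiped_height x y z : 0 <= x < 1 -> 0 <= y < 1 -> 0 <= z < 1 ->
  L (comb x y z) -> ~ levelZ (comb x y z) ->
  [/\ 1 < x + y + z, x + y + z < 2, 0 < x, 0 < y & 0 < z].
Proof.
move=> /andP[x0 x1] /andP[y0 y1] /andP[z0 z1] Lv nZ.
have neq (k : int) : x + y + z != k%:~R.
  by apply/eqP => e; apply: nZ; split=> //; exists k; rewrite dotv_comb e.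
(* A nonzero lattice point of the closed cone is totally positive, so its height is at least 1 in
   units of [c]. *)
have low X Y Z : 0 <= X -> 0 <= Y -> 0 <= Z -> 0 < X + Y + Z -> L (comb X Y Z) -> 1 <= X + Y + Z.
  move=> X0 Y0 Z0 S0 LX; have /supp := conj LX (posorth_comb X0 Y0 Z0 S0).
  by rewrite dotv_comb -[X in X <= _]mul1r ler_pM2r.
have s0 : 0 < x + y + z by rewrite lt_neqAle eq_sym (neq 0) !addr_ge0.
have s1 : 1 < x + y + z by rewrite lt_neqAle eq_sym (neq 1) low.
have [La _] := Pa; have [Lb _] := Pb; have [Ld _] := Pd.
have s2 : x + y + z < 2.
  rewrite lt_neqAle (neq 2) /=.
  have := low (1 - x) (1 - y) (1 - z);
    have -> : comb (1 - x) (1 - y) (1 - z) = a + b + d - comb x y z.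
    by apply/rowP => i; rewrite !mxE; ring.
  have LL : L (a + b + d - comb x y z) by apply: Lsub => //; apply: LD => //; apply: LD.
  move=> H; have h : 1 <= 1 - x + (1 - y) + (1 - z) by apply: H => //; lra.
  by lra.
split=> //.
- rewrite lt_neqAle x0 andbT; apply/eqP => e.
  have := low 0 (1 - y) (1 - z); have -> : comb 0 (1 - y) (1 - z) = b + d - comb x y z.
    by rewrite -e; apply/rowP => i; rewrite !mxE; ring.
  have LL : L (b + d - comb x y z) by apply: Lsub => //; apply: LD.
  move=> H; have h : 1 <= 0 + (1 - y) + (1 - z) by apply: H => //; lra.
  by lra.
- rewrite lt_neqAle y0 andbT; apply/eqP => e.
  have := low (1 - x) 0 (1 - z); have -> : comb (1 - x) 0 (1 - z) = a + d - comb x y z.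
    by rewrite -e; apply/rowP => i; rewrite !mxE; ring.
  have LL : L (a + d - comb x y z) by apply: Lsub => //; apply: LD.
  move=> H; have h : 1 <= (1 - x) + 0 + (1 - z) by apply: H => //; lra.
  by lra.
- rewrite lt_neqAle z0 andbT; apply/eqP => e.
  have := low (1 - x) (1 - y) 0; have -> : comb (1 - x) (1 - y) 0 = a + b - comb x y z.
    by rewrite -e; apply/rowP => i; rewrite !mxE; ring.
  have LL : L (a + b - comb x y z) by apply: Lsub => //; apply: LD.
  move=> H; have h : 1 <= (1 - x) + (1 - y) + 0 by apply: H => //; lra.
  by lra.
Qed.

(** From a coordinate at least 1 the vertex can be subtracted; the rest is nonzero because the
    height is not [c], so it is a totally positive lattice point and the vector decomposes. *)
Lemma indec_coord_lt1 x y z : 0 <= x -> 0 <= y -> 0 <= z -> indec P (comb x y z) ->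
  dotv u (comb x y z) <> c -> [/\ x < 1, y < 1 & z < 1].
Proof.
move=> x0 y0 z0 [[Lv _] nd] uc.
have s1 : x + y + z <> 1 by move=> e; apply: uc; rewrite dotv_comb e mul1r.
have key X Y Z p : 0 <= X -> 0 <= Y -> 0 <= Z -> 0 < X + Y + Z -> P p ->
    comb x y z = p + comb X Y Z -> False.
  move=> X0 Y0 Z0 S0 Pp e; apply: nd; exists p, (comb X Y Z); split=> //; split=> //.
  split; last exact: posorth_comb.
  rewrite (_ : comb X Y Z = comb x y z - p); last by rewrite e addrC addKr.
  by apply: Lsub => //; case: Pp.
split; rewrite ltNge; apply/negP => h.
- by apply: (key (x - 1) y z a); rewrite ?subr_ge0 //; [lra|apply/rowP => i; rewrite !mxE; ring].
- by apply: (key x (y - 1) z b); rewrite ?subr_ge0 //; [lra|apply/rowP => i; rewrite !mxE; ring].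
- by apply: (key x y (z - 1) d); rewrite ?subr_ge0 //; [lra|apply/rowP => i; rewrite !mxE; ring].
Qed.

End Triangle.

(* Descent on the area: if [v] has height [2] over the triangle [abd], then [a + b + d - v] is a
   lattice point of the triangle, and it can replace one vertex. *)
Lemma indec_height_neq2 v a b d x y z : a \in f -> b \in f -> d \in f -> det3 a b d != 0 ->
  0 <= x -> 0 <= y -> 0 <= z -> v = x *: a + y *: b + z *: d -> indec P v ->
  dotv u v <> 2 * c.
Proof.
move=> af bf df det x0 y0 z0 vE iv uv.
(* There are finitely many nondegenerate triangles on points of [f] whose cone contains [v]; one of
   least area is taken. In a fixed plane the determinant measures the area. *)
pose bad (t : V * V * V) := det3 t.1.1 t.1.2 t.2 != 0 /\ exists x y z,
  [/\ 0 <= x, 0 <= y, 0 <= z & v = x *: t.1.1 + y *: t.1.2 + z *: t.2].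
pose T := [seq t <- [seq (p, t) | p <- [seq (p, q) | p <- f, q <- f], t <- f] | `[< bad t >]].
have TP t : t \in T <-> [/\ t.1.1 \in f, t.1.2 \in f, t.2 \in f & bad t].
  rewrite mem_filter; split=> [/andP[/asboolP bt /allpairsP[[p r] /= [pf rf tE]]]|[h1 h2 h3 bt]].
    case/allpairsP: pf => -[q q'] /= [qf qf' pE].
    by rewrite tE pE /=; split=> //; rewrite -pE -tE.
  apply/andP; split; first exact/asboolP.
  apply/allpairsP; exists (t.1, t.2); split=> //=; last by case: (t).
  by apply/allpairsP; exists (t.1.1, t.1.2); split=> //=; case: (t) => -[].
have : (a, b, d) \in T by apply/TP; split=> //; split=> //; exists x, y, z.
move=> /(seq_argmin (fun t => `|det3 t.1.1 t.1.2 t.2|)) [[[a' b'] d'] /TP[/= af' bf' df' [/=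
  det' [x' [y' [z' [x0' y0' z0' vE']]]]]] min].
move: a' b' d' x' y' z' af' bf' df' det' x0' y0' z0' vE' min {a b d x y z af bf df det x0 y0 z0
  vE}.
move=> a b d x y z af bf df det x0 y0 z0 vE min.
have s2 : x + y + z = 2.
  by apply: (mulIf (lt0r_neq0 c0)); rewrite -(dotv_comb af bf df) -vE uv.
have [||x1 y1 z1] := indec_coord_lt1 af bf df x0 y0 z0; first by rewrite -vE.
  by rewrite -vE uv; move: c0 => ? ?; lra.
pose w := a + b + d - v.
have wE : w = (1 - x) *: a + (1 - y) *: b + (1 - z) *: d.
  by rewrite /w vE; apply/rowP => i; rewrite !mxE; ring.
have wf : w \in f.
  have [[La _] ua] := (fP a).1 af; have [[Lb _] ub] := (fP b).1 bf;
    have [[Ld _] ud] := (fP d).1 df.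
  apply/fP; split; last by rewrite dotvB !dotvD ua ub ud uv; ring.
  split; last by rewrite wE; apply: (posorth_comb af bf df); lra.
  apply: Lsub; last by case: iv => -[].
  by do 2?[apply: sub_closedD => //].
(* If [X] is the smallest coefficient, replacing [p] by [w] keeps [v] in the cone and multiplies the
   determinant by [1 - X], against minimality. *)
have step p q r (X Y Z : R) : p \in f -> q \in f -> r \in f -> `|det3 p q r| = `|det3 a b d| ->
    w = (1 - X) *: p + (1 - Y) *: q + (1 - Z) *: r -> v = X *: p + Y *: q + Z *: r ->
    0 < X -> X < 1 -> X <= Y -> X <= Z -> False.
  move=> pf qf rf dE wE' vE' X0 X1 XY XZ.
  have n1 : 1 - X != 0 by rewrite gt_eqF // subr_gt0.
  have dw : det3 w q r = (1 - X) * det3 p q r by rewrite wE' /det3 !mxE; ring.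
  have dn : det3 p q r != 0 by rewrite -normr_eq0 dE normr_eq0.
  have /min : (w, q, r) \in T.
    apply/TP; split=> //=; split; rewrite /= ?dw ?mulf_neq0 //.
    exists (X / (1 - X)), ((Y - X) / (1 - X)), ((Z - X) / (1 - X)); split.
    - by rewrite divr_ge0 ?subr_ge0 // ltW.
    - by rewrite divr_ge0 ?subr_ge0 // ltW.
    - by rewrite divr_ge0 ?subr_ge0 // ltW.
    - by rewrite vE' wE'; apply/rowP => i; rewrite !mxE; field.
  rewrite /= dw normrM dE ger0_norm ?subr_ge0 ?(ltW X1) //.
  rewrite leNgt => /negP; apply; rewrite gtr_pMl ?normr_gt0 //; lra.
have [xp yp zp] : [/\ 0 < x, 0 < y & 0 < z] by split; lra.
(* Cyclic permutations bring the smallest coefficient to the front. *)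
have permA : w = (1 - z) *: d + (1 - x) *: a + (1 - y) *: b /\ v = z *: d + x *: a + y *: b.
  by rewrite wE [in X in _ /\ X]vE; split; apply/rowP => i; rewrite !mxE; ring.
have permB : w = (1 - y) *: b + (1 - z) *: d + (1 - x) *: a /\ v = y *: b + z *: d + x *: a.
  by rewrite wE [in X in _ /\ X]vE; split; apply/rowP => i; rewrite !mxE; ring.
have detA : `|det3 d a b| = `|det3 a b d| by congr (`|_|); rewrite /det3; ring.
have detB : `|det3 b d a| = `|det3 a b d| by congr (`|_|); rewrite /det3; ring.
have [xy|/ltW xy] := lerP x y.
  have [xz|/ltW xz] := lerP x z; first exact: (step a b d x y z).
  have zy : z <= y := le_trans xz xy.
  by case: permA => wA vA; exact: (step d a b z x y).
have [yz|/ltW yz] := lerP y z; first by case: permB => wB vB; exact: (step b d a y z x).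
have zx : z <= x := le_trans yz xy.
by case: permA => wA vA; exact: (step d a b z x y).
Qed.

Lemma levelZ0 : f != [::] -> levelZ 0.
Proof.
case: f fP => // p s fP' _; have [[Lp _] _] := (fP' p).1 (mem_head _ _).
by split; [rewrite -(subrr p); apply: Lsub|exists 0; rewrite dotv0 mul0r].
Qed.

Lemma levelZ_sub x y : levelZ x -> levelZ y -> levelZ (x - y).
Proof.
move=> [Lx [m mE]] [Ly [n nE]]; split; first exact: Lsub.
by exists (m - n); rewrite dotvB mE nE rmorphB /= mulrBl.
Qed.

(** * Counting the points of the half-open parallelepiped by cosets *)

Section TriangleCount.
Variables a b d : V.
Hypotheses (af : a \in f) (bf : b \in f) (df : d \in f).
Hypothesis det : det3 a b d != 0.

Let comb x y z : V := x *: a + y *: b + z *: d.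
Let co := tri_coord a b d.
Let coK v : comb (co 0 v) (co 1 v) (co 2%:R v) = v.
Proof. exact: tri_coordK. Qed.

Let Pa : P a. Proof. by have [] := (fP a).1 af. Qed.
Let Pb : P b. Proof. by have [] := (fP b).1 bf. Qed.
Let Pd : P d. Proof. by have [] := (fP d).1 df. Qed.
Let ua : dotv u a = c. Proof. by have [] := (fP a).1 af. Qed.
Let ub : dotv u b = c. Proof. by have [] := (fP b).1 bf. Qed.
Let ud : dotv u d = c. Proof. by have [] := (fP d).1 df. Qed.
Let L0 : L 0. Proof. by case: Pa => La _; exact: (sub_closed0 Lsub La). Qed.
Let LD v w : L v -> L w -> L (v + w). Proof. exact: sub_closedD. Qed.
Let Lz v (z : int) : L v -> L (z%:~R *: v).
Proof. by move=> Lv; rewrite scaler_int; apply: sub_closedMz. Qed.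

Definition frac (x : R) : R := x - (Num.floor x)%:~R.

Lemma frac_itv x : 0 <= frac x < 1.
Proof.
have := floor_le x; have := floorD1_gt x; rewrite rmorphD /= /frac => h1 h2.
by apply/andP; split; lra.
Qed.

Lemma frac_eq x y (m : int) : x - y = m%:~R -> frac x = frac y.
Proof.
move=> e; rewrite /frac (_ : Num.floor x = Num.floor y + m).
  by rewrite rmorphD /= -e; ring.
apply: floor_def; have := floor_le y; have := floorD1_gt y; rewrite !rmorphD /= => h1 h2.
by apply/andP; split; lra.
Qed.

Lemma frac_id x : 0 <= x < 1 -> frac x = x.
Proof. by move=> h; rewrite /frac (@floor_def _ _ 0) ?subr0. Qed.

(** The representative of [v] in the half-open parallelepiped, modulo the lattice generated by the
    three vertices. *)
Definition fracpart v := comb (frac (co 0 v)) (frac (co 1 v)) (frac (co 2%:R v)).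

Let zlat : set V := [set x | exists m n k : int, x = comb m%:~R n%:~R k%:~R].

Let zlat_fracpart v : zlat (v - fracpart v).
Proof.
exists (Num.floor (co 0 v)), (Num.floor (co 1 v)), (Num.floor (co 2%:R v)).
by rewrite -[X in X - _]coK /fracpart /frac; apply/rowP => i; rewrite !mxE; ring.
Qed.

Let zlatL v : zlat v -> L v.
Proof.
have [La _] := Pa; have [Lb _] := Pb; have [Ld _] := Pd.
by move=> [m [n [k ->]]]; apply: LD; [apply: LD|]; apply: Lz.
Qed.

Let zlat_level v : zlat v -> levelZ v.
Proof.
move=> zv; split; first exact: zlatL.
have [m [n [k ->]]] := zv; exists (m + n + k).
by rewrite (dotv_comb af bf df) !rmorphD.
Qed.

Let L_fracpart v : L v -> L (fracpart v).
Proof.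
move=> Lv; rewrite -[fracpart v](subKr v); apply: Lsub => //; exact/zlatL/zlat_fracpart.
Qed.

Let fracpart_eq v w : zlat (v - w) -> fracpart v = fracpart w.
Proof.
move=> [m [n [k e]]]; have E i : co i v - co i w = row3 m%:~R n%:~R k%:~R 0 i.
  by rewrite /co -tri_coordB e tri_coord_comb.
rewrite /fracpart; congr (comb _ _ _).
- by apply: (@frac_eq _ _ m); rewrite E mxE.
- by apply: (@frac_eq _ _ n); rewrite E mxE.
- by apply: (@frac_eq _ _ k); rewrite E mxE.
Qed.

Let fracpart_comb x y z : 0 <= x < 1 -> 0 <= y < 1 -> 0 <= z < 1 ->
  fracpart (comb x y z) = comb x y z.
Proof.
by move=> hx hy hz; rewrite /fracpart /co !tri_coord_comb // !mxE /= !frac_id.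
Qed.

Let E := [set x | x = b - a \/ x = d - a].

Lemma zspan_edges x : zspan E x <-> exists m n : int, x = m%:~R *: (b - a) + n%:~R *: (d - a).
Proof.
split=> [[n [p [w [pE ->]]]]|[m [n ->]]]; last first.
  exists 2%N, (fun i => if i == 0 then b - a else d - a), (fun i => if i == 0 then m else n).
  split; first by move=> i; case: ifP => _; [left|right].
  by rewrite !big_ord_recl big_ord0 addr0 /= !scaler_int.
elim/big_ind: _ => [|y z [m [k ->]] [m' [k' ->]]|i _].
- by exists 0, 0; rewrite !scale0r addr0.
- by exists (m + m'), (k + k'); rewrite !rmorphD /= !scalerDl addrACA.
- by case: (pE i) => ->; [exists (w i), 0|exists 0, (w i)];
  rewrite scale0r ?addr0 ?add0r scaler_int.
Qed.

Lemma rspan_edges x : rspan E x <-> dotv u x = 0.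
Proof.
split=> [[n [p [w [pE ->]]]]|ux].
  rewrite dotv_sum big1 // => i _; rewrite dotvZ.
  by case: (pE i) => ->; rewrite dotvB ?ua ?ub ?ud subrr mulr0.
exists 2%N, (fun i => if i == 0 then b - a else d - a), (fun i =>
  if i == 0 then co 1 x else co 2%:R x).
split; first by move=> i; case: ifP => _; [left|right].
rewrite !big_ord_recl big_ord0 addr0 /=.
have /eqP s0 : co 0 x + co 1 x + co 2%:R x == 0.
  have : (co 0 x + co 1 x + co 2%:R x) * c == 0 by rewrite -(dotv_comb af bf df) -/(comb _ _ _)
    coK ux.
  by rewrite mulf_eq0 (gt_eqF c0) orbF.
have e : co 0 x = - co 1 x - co 2%:R x by lra.
by rewrite -[x in LHS]coK e; apply/rowP => i; rewrite !mxE; ring.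
Qed.

(** Together with the converse [zlat_edges]: the edges generate exactly the part of [zlat] at height
    zero, which links [IV_tri] to [zlat]. *)
Let edges_zlat x : zspan E x -> zlat x /\ dotv u x = 0.
Proof.
move=> h; split.
  have [m [n ->]] := (zspan_edges x).1 h; exists (- (m + n)), m, n.
  by rewrite rmorphN rmorphD /=; apply/rowP => i; rewrite !mxE; ring.
by apply/rspan_edges; case: h => n [p [w [pE ->]]]; exists n, p, (fun i => (w i)%:~R);
  split=> //; apply: eq_bigr => i _; rewrite scaler_int.
Qed.

Let zlat_edges x : zlat x -> dotv u x = 0 -> zspan E x.
Proof.
move=> [m [n [k ->]]] /eqP; rewrite (dotv_comb af bf df) mulf_eq0 (gt_eqF c0) orbF => /eqP s0.
apply/zspan_edges; exists n, k; have e : m%:~R = - n%:~R - k%:~R :> R by lra.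
by rewrite e; apply/rowP => i; rewrite !mxE; ring.
Qed.

Lemma zspan_edges_sub x y : zspan E x -> zspan E y -> zspan E (x - y).
Proof.
move=> /zspan_edges[m [n ->]] /zspan_edges[m' [n' ->]]; apply/zspan_edges.
by exists (m - m'), (n - n'); rewrite !rmorphB /= !scalerBl opprD addrACA.
Qed.

Lemma zspan_edges0 : zspan E 0.
Proof. by apply/zspan_edges; exists 0, 0; rewrite !scale0r addr0. Qed.

Let box_seq (B : R) : exists X : seq V, forall v, v \in X <-> L v /\ forall i, `|v 0 i| <= B.
Proof.
have /finite_seqP[X XE] := Lfin B; exists X => v.
by have := congr1 (fun A : set V => A v) XE; rewrite /= => ->.
Qed.

Let entry_bound (v : V) i : `|v 0 i| <= `|v 0 0| + `|v 0 1| + `|v 0 2%:R|.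
Proof.
have n0 := normr_ge0 (v 0 0); have n1 := normr_ge0 (v 0 1); have n2 := normr_ge0 (v 0 2%:R).
by move: i; apply: ord3P; lra.
Qed.

Let bnd (v : V) := `|v 0 0| + `|v 0 1| + `|v 0 2%:R|.

(** Fractional parts lie in a bounded box, so finitely many lattice points represent [L] modulo
    [zlat], hence also modulo the larger group [levelZ]. *)
Lemma index_levelZ : exists n, is_index L levelZ n.
Proof.
have [X XP] := box_seq (bnd a + bnd b + bnd d).
apply: (@exists_index _ _ _ _ _ X).
- by apply: levelZ0; apply/eqP => f0; move: af; rewrite f0.
- exact: levelZ_sub.
- by move=> x /XP[].
move=> g Lg; exists (fracpart g); last exact/zlat_level/zlat_fracpart.
apply/XP; split; first exact: L_fracpart.
move=> i; rewrite !mxE.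
have key (t : R) (v : V) : 0 <= t < 1 -> `|t * v 0 i| <= bnd v.
  move=> /andP[t0 t1]; rewrite normrM ger0_norm //; apply: le_trans (entry_bound v i).
  by rewrite ler_piMl // ltW.
by rewrite (le_trans (ler_normD _ _)) // lerD ?key ?frac_itv // (le_trans (ler_normD _ _)) //
  lerD ?key ?frac_itv.
Qed.

(** The same argument at height zero, with fractional parts taken along the two edges. *)
Lemma index_edges : exists n, is_index (L `&` rspan E) (zspan E) n.
Proof.
have [X XP] := box_seq (bnd (b - a) + bnd (d - a)).
have [La _] := Pa; have [Lb _] := Pb; have [Ld _] := Pd.
pose Y := [seq v <- X | `[< dotv u v = 0 >]].
apply: (@exists_index _ _ _ _ _ Y).
- exact: zspan_edges0.
- exact: zspan_edges_sub.
- by move=> x; rewrite mem_filter => /andP[/asboolP h /XP[Lx _]]; split=> //; apply/rspan_edges.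
move=> g [Lg /rspan_edges ug].
pose h := (Num.floor (co 1 g))%:~R *: (b - a) + (Num.floor (co 2%:R g))%:~R *: (d - a).
have hE : zspan E h by apply/zspan_edges; exists (Num.floor (co 1 g)), (Num.floor (co 2%:R g)).
exists (g - h); last by rewrite subKr.
have uh : dotv u (g - h) = 0 by rewrite dotvB ug (edges_zlat hE).2 subrr.
rewrite mem_filter; apply/andP; split; first exact/asboolP.
apply/XP; split; first by apply: Lsub => //; apply/zlatL; case: (edges_zlat hE).
have gE : g - h = frac (co 1 g) *: (b - a) + frac (co 2%:R g) *: (d - a).
  have s0 : co 0 g = - co 1 g - co 2%:R g.
    apply: (mulIf (lt0r_neq0 c0)); have := dotv_comb af bf df (co 0 g) (co 1 g) (co 2%:R g).
    by rewrite -/(comb _ _ _) coK ug; lra.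
  by rewrite -[g in LHS]coK s0 /h /frac; apply/rowP => i; rewrite !mxE; ring.
move=> i; rewrite gE.
have key (t : R) (v : V) : 0 <= t < 1 -> `|(t *: v) 0 i| <= bnd v.
  move=> /andP[t0 t1]; rewrite mxE normrM ger0_norm //; apply: le_trans (entry_bound v i).
  by rewrite ler_piMl // ltW.
by rewrite mxE (le_trans (ler_normD _ _)) // lerD ?key ?frac_itv.
Qed.

(** Each class of [L] modulo [zlat] has one point in the half-open parallelepiped. Subtracting
    multiples of [a] identifies [levelZ] modulo [zlat] with the height-zero lattice modulo the
    edges, of order [n]. So each of the [m - 1] nonzero classes modulo [levelZ] contributes [n]
    points, and these are the required indecomposables. *)
Lemma indec_triangle_count m n : is_index L levelZ m -> is_index (L `&` rspan E) (zspan E) n ->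
  exists l : seq V, [/\ uniq l, size l = ((m - 1) * n)%N,
    forall v, v \in l -> [/\ indec P v, dotv u v <> c &
      exists x y z, [/\ 0 < x, 0 < y, 0 < z & v = x *: a + y *: b + z *: d]]
  & forall v x y z, 0 <= x -> 0 <= y -> 0 <= z -> v = x *: a + y *: b + z *: d ->
      indec P v -> dotv u v <> c -> v \in l].
Proof.
have Z0 : levelZ 0 by apply: levelZ0; apply/eqP => f0; move: af; rewrite f0.
move=> /(is_indexP Z0)[s [us <- sL sinj scov]].
move=> /(is_indexP zspan_edges0)[r [ur <- rL rinj rcov]].
pose s' := [seq x <- s | `[< ~ levelZ x >]].
have ZD x y : levelZ x -> levelZ y -> levelZ (x + y).
  move=> hx hy; rewrite -[y]opprK; apply: levelZ_sub => //; rewrite -sub0r; exact: levelZ_sub.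
(* Exactly one representative, that of the class of 0, lies in [levelZ]. *)
have sz : size s' = (size s - 1)%N.
  have [k ks kZ] := scov 0 L0.
  have kZ' : levelZ k by rewrite -[k]opprK -sub0r -[- k]sub0r; apply: levelZ_sub.
  have -> : s' = [seq x <- s | x != k].
    apply: eq_in_filter => x xs; apply/asboolP/idP => [nx|/eqP xk Zx]; first by apply/eqP => e;
      apply: nx; rewrite e.
    by apply: xk; apply: sinj => //; apply: levelZ_sub.
  have := count_predC (pred1 k) s; rewrite (count_uniq_mem _ us) ks add1n => <-.
  by rewrite subn1 size_filter.
have rZ x : x \in r -> levelZ x.
  by move=> /rL[Lx /rspan_edges h]; split=> //; exists 0; rewrite h mul0r.
exists [seq fracpart (x + y) | x <- s', y <- r]; split.
- apply: allpairs_uniq => //; first exact: filter_uniq.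
  move=> [x y] [x' y'] /allpairsP[[x1 y1] /= [xs yr [-> ->]]] /allpairsP[[x2 y2] /= [xs' yr' [->
    ->]]] /= e.
  move: xs xs'; rewrite !mem_filter => /andP[_ xs] /andP[_ xs'].
  (* Equal fractional parts mean congruence modulo [zlat]. This determines first the class modulo
     [levelZ], then the height-zero part modulo the edges. *)
  have zz : zlat ((x1 + y1) - (x2 + y2)).
    have [m1 [n1 [k1 e1]]] := zlat_fracpart (x1 + y1).
    have [m2 [n2 [k2 e2]]] := zlat_fracpart (x2 + y2).
    exists (m1 - m2), (n1 - n2), (k1 - k2).
    rewrite (_ : _ - _ = (x1 + y1 - fracpart (x1 + y1)) - (x2 + y2 - fracpart (x2 + y2))).
      by rewrite e1 e2 !rmorphB /=; apply/rowP => i; rewrite !mxE; ring.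
    by rewrite e; apply/rowP => i; rewrite !mxE; ring.
  have x12 : x1 = x2.
    apply: sinj => //.
    rewrite (_ : x1 - x2 = ((x1 + y1) - (x2 + y2)) - (y1 - y2)); last by apply/rowP => i;
      rewrite !mxE; ring.
    by apply: levelZ_sub; [exact: zlat_level|apply: levelZ_sub; exact: rZ].
  rewrite x12; congr (_, _); apply: rinj => //.
  apply: zlat_edges; last first.
    by have [_ /rspan_edges h1] := rL _ yr; have [_ /rspan_edges h2] := rL _ yr';
      rewrite dotvB h1 h2 subrr.
  by move: zz; rewrite x12 opprD addrACA subrr add0r.
- by rewrite size_allpairs sz.
- move=> v /allpairsP[[x y] /= [xs yr ->]]; move: xs; rewrite mem_filter => /andP[/asboolP nx xs].
  have Lw : L (fracpart (x + y)) by apply: L_fracpart; apply: LD; [exact: sL|case: (rL _ yr)].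
  have nw : ~ levelZ (fracpart (x + y)).
    move=> h; apply: nx.
    rewrite (_ : x = (x + y - fracpart (x + y)) + (fracpart (x + y) - y));
      last by apply/rowP => i; rewrite !mxE; ring.
    by apply: ZD; [exact/zlat_level/zlat_fracpart|apply: levelZ_sub => //; exact: rZ].
  have f0 := frac_itv (co 0 (x + y)); have f1 := frac_itv (co 1 (x + y));
    have f2 := frac_itv (co 2%:R (x + y)).
  have [s1 s2 p0 p1 p2] := parallelepiped_height af bf df f0 f1 f2 Lw nw.
  split; last by exists (frac (co 0 (x + y))), (frac (co 1 (x + y))), (frac (co 2%:R (x + y))).
  + apply: indec_below; last by rewrite (dotv_comb af bf df) ltr_pM2r.
    by split=> //; apply: (posorth_comb af bf df); rewrite ?ltW //; lra.
  + by rewrite (dotv_comb af bf df); rewrite -[X in _ <> X]mul1r => /(mulIf (lt0r_neq0 c0)); lra.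
move=> v x y z x0 y0 z0 vE iv uv.
have [||x1 y1 z1] := indec_coord_lt1 af bf df x0 y0 z0; [by rewrite -vE|by rewrite -vE|].
have Lv : L v by case: iv => -[].
(* An integral height is positive and below 3. Height 1 is excluded by hypothesis, height 2 by the
   descent on the area. *)
have nv : ~ levelZ v.
  move=> [_ [k kE]]; have h := kE; rewrite vE (dotv_comb af bf df) in h.
  have {}h := mulIf (lt0r_neq0 c0) h.
  have [_ vp] := iv.1.
  have k0 : 0 < k.
    rewrite -(ltr_int R) -(pmulr_lgt0 _ c0) -kE; exact: lt_le_trans (supp iv.1).
  have k3 : k < 3 by rewrite -(ltr_int R) -h; lra.
  have [e|e] : k = 1 \/ k = 2 by lia.
    by apply: uv; rewrite kE e mul1r.
  by apply: (indec_height_neq2 af bf df det x0 y0 z0 vE iv); rewrite kE e.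
have [k ks kZ] := scov v Lv.
have [_ [t tE]] := kZ.
have [Lk La] : L k /\ L a by split; [exact: sL|case: Pa].
(* [v - k] has integral height [t]; subtracting [t] copies of [a] brings it to height zero, where
   [r] has a representative. *)
have [|y' yr ye] := rcov (v - k - t%:~R *: a).
  split; first by apply: Lsub; [exact: Lsub|exact: Lz].
  by apply/rspan_edges; rewrite dotvB tE dotvZ ua subrr.
apply/allpairsP; exists (k, y'); split=> //=.
  rewrite mem_filter ks andbT; apply/asboolP => Zk; apply: nv.
  by rewrite -[v](subrK k); apply: ZD.
have -> : v = fracpart v.
  by rewrite [in RHS]vE -/(comb _ _ _) fracpart_comb ?x0 ?y0 ?z0.
apply: fracpart_eq; have [[m1 [n1 [k1 e1]]] _] := edges_zlat ye.
exists (m1 + t), n1, k1.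
rewrite (_ : v - (k + y') = (v - k - t%:~R *: a - y') + t%:~R *: a); last by apply/rowP => i;
  rewrite !mxE; ring.
by rewrite e1 rmorphD /=; apply/rowP => i; rewrite !mxE; ring.
Qed.

End TriangleCount.
End Count.

(** * Faces of the sail *)

Section Assembly.
Variable R : realType.
Local Notation V := 'rV[R]_3.
Local Notation conv := (@Defs.conv R).

Lemma conv_sub (S T : set V) : S `<=` T -> conv S `<=` conv T.
Proof.
move=> ST x [n [p [w [Sp [w0 [w1 ->]]]]]]; exists n, p, w; split; last by split.
by move=> i; apply: ST.
Qed.

Lemma cone_verts (a b d x : V) : cone (verts (a, b, d)) x <->
  exists k l m, [/\ 0 <= k, 0 <= l, 0 <= m & x = k *: a + l *: b + m *: d].
Proof.
split=> [|[k [l [m [k0 l0 m0 ->]]]]]; last first.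
  do 2?[apply: cone_add]; apply: cone_scale => //; apply: cone_gen;
    by [left|right; left|right; right].
elim=> [|w p y w0 Tp _ [k [l [m [k0 l0 m0 ->]]]]].
  by exists 0, 0, 0; rewrite !scale0r !addr0.
case: Tp => [->|[->|->]].
- by exists (w + k), l, m; split; rewrite ?addr_ge0 // scalerDl !addrA.
- by exists k, (w + l), m; split; rewrite ?addr_ge0 //; apply/rowP => i; rewrite !mxE; ring.
- by exists k, l, (w + m); split; rewrite ?addr_ge0 //; apply/rowP => i; rewrite !mxE; ring.
Qed.

(** Three points of such a cone have zero determinant, so a two-dimensional face needs at least
    three vertices. Missing generators are replaced by the default 0. *)
Lemma cone_le2 (s : seq V) : (size s <= 2)%N ->
  exists a b : V, forall x, cone [set` s] x -> exists k l, x = k *: a + l *: b.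
Proof.
move=> s2; exists s`_0, s`_1 => x; elim=> [|w p y w0 /= ps _ [k [l ->]]].
  by exists 0, 0; rewrite !scale0r addr0.
have [->|->] : p = s`_0 \/ p = s`_1.
  case: s s2 ps => [|a [|b [|]]] //= _; rewrite !inE; first by move=> /eqP ->; left.
  by move=> /orP[] /eqP ->; [left|right].
- by exists (w + k), l; rewrite scalerDl addrA.
- by exists k, (w + l); rewrite scalerDl addrCA.
Qed.

Lemma triP (u : V) (c : R) (a b d x : V) : 0 < c -> dotv u a = c -> dotv u b = c ->
  dotv u d = c ->
  tri (a, b, d) x <-> cone (verts (a, b, d)) x /\ dotv u x = c.
Proof. by move=> c0 ua ub ud; apply: conv_coneP => // p [->|[->|->]]. Qed.

Lemma uniq_flatten_disjoint (I : eqType) (T : eqType) (x0 : I) (g : I -> seq T) (D : seq I) :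
  (forall t, t \in D -> uniq (g t)) ->
  (forall i j, (i < size D)%N -> (j < size D)%N -> i != j ->
     forall v, v \in g (nth x0 D i) -> v \in g (nth x0 D j) -> False) ->
  uniq (flatten [seq g t | t <- D]).
Proof.
elim: D => //= t D ih ug dis; rewrite cat_uniq ug ?mem_head // ih /=; last first.
- by move=> i j si sj ij; apply: (dis i.+1 j.+1).
- by move=> t' t'D; apply: ug; rewrite inE t'D orbT.
rewrite andbT; apply/hasPn => v /flattenP[_ /mapP[t' t'D ->] vt'].
apply/negP => vt; apply: (dis 0%N (index t' D).+1 _ _ _ v) => //=.
  by rewrite ltnS index_mem.
by rewrite nth_index.
Qed.

(** A lattice point [x] of height [k] is the sum of [x - k a + a], of height 1, and [k - 1] copies
    of [a]. *)
Lemma zspan_level (L : set V) (u : V) (c : R) (a : V) : (forall v w, L v -> L w -> L (v - w)) ->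
  L a -> dotv u a = c -> zspan [set v | dotv u v = c /\ L v] = levelZ L u c.
Proof.
move=> Lsub La ua.
have L0 : L 0 := sub_closed0 Lsub La.
have LD v w : L v -> L w -> L (v + w) by exact: sub_closedD.
have Lz v (z : int) : L v -> L (v *~ z) by exact: sub_closedMz.
have uz v (z : int) : dotv u (v *~ z) = z%:~R * dotv u v by rewrite -scaler_int dotvZ.
apply/seteqP; split=> x.
  move=> [n [p [w [pA ->]]]]; elim/big_ind: _ => [|y z [Ly [k kE]] [Lz' [l lE]]|i _].
  - by split=> //; exists 0; rewrite dotv0 mul0r.
  - by split; [exact: LD|exists (k + l); rewrite dotvD kE lE rmorphD /= mulrDl].
  - by have [e Lp] := pA i; split; [exact: Lz|exists (w i); rewrite uz e].
move=> [Lx [k kE]].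
exists 2%N, (fun i => if i == 0 then x - a *~ k + a else a), (fun i =>
  if i == 0 then 1 else k - 1).
split.
  move=> i; case: ifP => _; split=> //.
    by rewrite dotvD dotvB uz kE ua subrr add0r.
  by apply: (LD) => //; apply: (Lsub) => //; apply: (Lz).
rewrite !big_ord_recl big_ord0 addr0 /= mulr1z mulrzBr mulr1z; set y := a *~ k.
by apply/rowP => i; rewrite !mxE; ring.
Qed.

Variable K : fieldExtType rat.
Hypothesis hdeg : \dim {:K} = 3%N.
Variable tau : 'I_3 -> {rmorphism K -> R}.
Hypothesis htau : forall i j : 'I_3, i != j -> exists x : K, tau i x != tau j x.

Local Notation L := (Lambda tau).
Local Notation P := (L `&` @posorth R).

Let Lsub := @Lambda_sub R K tau.
Let Lfin := Lambda_finite hdeg htau.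

Lemma totposP a : totpos tau a <-> P (iotaM tau a).
Proof.
split=> [[ai ap]|[[b [bi /iotaM_inj ->]] bp]].
  by split; [exists a|move=> i; rewrite mxE].
by split=> // i; have := bp i; rewrite mxE.
Qed.

Lemma indecomposableP a : indecomposable tau a <-> indec P (iotaM tau a).
Proof.
have iD x y : iotaM tau (x + y) = iotaM tau x + iotaM tau y.
  by apply/rowP => i; rewrite !mxE rmorphD.
split=> [[/totposP Pa nd]|[/totposP Pa nd]]; split=> //.
  move=> [p [q [[[x [xi xE]] pp] [[[y [yi yE]] qp] e]]]]; apply: nd; exists x, y; split.
    by apply/totposP; rewrite -xE; split=> //; exists x.
  split; first by apply/totposP; rewrite -yE; split=> //; exists y.
  by apply: (@iotaM_inj _ _ tau); rewrite e xE yE iD.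
move=> [x [y [/totposP Px [/totposP Py e]]]]; apply: nd.
by exists (iotaM tau x), (iotaM tau y); split=> //; split=> //; rewrite e iD.
Qed.

Variables (u : V) (c : R) (F : set V).
Hypothesis c0 : 0 < c.
Hypothesis supp : forall p, P p -> c <= dotv u p.
Variable f : seq V.
Hypothesis fP : forall v, v \in f <-> P v /\ dotv u v = c.
Hypothesis FP : forall x, F x <-> cone [set` f] x /\ dotv u x = c.

Let fu v : v \in f -> dotv u v = c. Proof. by move=> /fP[]. Qed.

Lemma exists_int_decomposition p0 p1 p2 : F p0 -> F p1 -> F p2 ->
  \rank (col_mx (p1 - p0) (p2 - p0)) = 2%N -> exists D, int_decomposition tau F D.
Proof.
move=> /FP[C0 u0] /FP[C1 u1] /FP[C2 u2] /(tri_rank_det c0 u0 u1 u2) dn.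
have [s [us sf irr Cs]] := irredundant_cone f.
have su v : v \in s -> dotv u v = c by move=> /sf /fu.
have s2 : (2 < size s)%N.
  rewrite ltnNge; apply/negP => /cone_le2[a [b H]].
  have [k0 [l0 e0]] := H _ (Cs _ C0); have [k1 [l1 e1]] := H _ (Cs _ C1).
  have [k2 [l2 e2]] := H _ (Cs _ C2).
  by move/eqP: dn; apply; rewrite e0 e1 e2 /det3 !mxE; ring.
have [D [Ds Dc Dd]] := triangulation c0 us s2 su irr.
exists D; split.
  move=> [[a b] d] /Ds[/= as_ bs ds det].
  have LL v : v \in s -> L v by move=> /sf/fP[[]].
  split; first exact: LL; split; first exact: LL; split; first exact: LL.
  by apply/(tri_rank_det c0 (su _ as_) (su _ bs) (su _ ds)).
split=> // x; split.
  move=> /FP[Cx ux]; have [[[a b] d] tD Ct] := Dc x (Cs _ Cx); exists (a, b, d) => //.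
  have [/= as_ bs ds _] := Ds _ tD.
  by apply/(triP x c0 (su _ as_) (su _ bs) (su _ ds)).
move=> [[[a b] d] tD]; have [/= as_ bs ds _] := Ds _ tD.
move=> /(triP x c0 (su _ as_) (su _ bs) (su _ ds))[Ct ux]; apply/FP; split=> //.
by apply: cone_sub Ct => y [->|[->|->]]; exact: sf.
Qed.

(** * Summation over the triangles of a decomposition *)

Section Decomposition.
Variable D : seq (V * V * V).
Hypothesis hD : int_decomposition tau F D.

Let vertex_in t v : t \in D -> verts t v -> F v.
Proof.
case: hD => _ [Dc _] tD tv; apply/Dc; exists t => //.
by move: tv; case: (t) => -[a b] d tv; apply: conv_gen.
Qed.

(** A lattice point of [F] is a nonzero nonnegative combination of totally positive points, so it is
    itself totally positive and belongs to [f]. *)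
Let triangleP a b d : (a, b, d) \in D -> [/\ a \in f, b \in f, d \in f & det3 a b d != 0].
Proof.
move=> tD; have [Dt _] := hD; have [La [Lb [Ld rk]]] := Dt _ tD.
have FL v : L v -> F v -> v \in f.
  move=> Lv /FP[Cv uv]; apply/fP; split=> //; split=> // i.
  have nz : cone [set` f] v -> v = 0 \/ posorth v.
    elim=> [|w p y w0 /= /fP[[_ pp] _] _ [->|yp]]; first by left.
      have [->|w1] := eqVneq w 0; first by left; rewrite scale0r addr0.
      by right=> j; rewrite !mxE addr0 mulr_gt0 // lt_neqAle eq_sym w1.
    by right=> j; rewrite !mxE ltr_wpDl // mulr_ge0 // ltW.
  case: (nz Cv) => [v0|]; last by apply.
  by move: c0; rewrite -uv v0 dotv0 ltxx.
have af : a \in f by apply: FL => //; apply: (vertex_in tD); left.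
have bf : b \in f by apply: FL => //; apply: (vertex_in tD); right; left.
have df : d \in f by apply: FL => //; apply: (vertex_in tD); right; right.
by split=> //; apply/(tri_rank_det c0 (fu af) (fu bf) (fu df)).
Qed.

Let sum_fun3 (a b d : V) (w : V) : \sum_(i < 3) (w 0 i) *: (if i == 0 then a else if i == 1 then
  b else d)
  = w 0 0 *: a + w 0 1 *: b + w 0 2%:R *: d.
Proof. by rewrite sum3. Qed.

(** One nondegenerate triangle makes the affine hull of [F] the whole plane at height [c], whose
    span is everything; the subgroup in [ID] is then [levelZ]. *)
Let ID_index a b d : (a, b, d) \in D -> is_index L (levelZ L u c) (ID tau F).
Proof.
move=> tD; have [af bf df det] := triangleP tD.
have Fv i : F (if i == 0 then a else if i == 1 :> 'I_3 then b else d).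
  by apply: (vertex_in tD); case: ifP => _; [left|case: ifP => _; right; [left|right]].
pose w (v : V) : V := \row_i tri_coord a b d i v.
have wE v : v = \sum_i w v 0 i *: (if i == 0 then a else if i == 1 then b else d).
  by rewrite sum_fun3 !mxE tri_coordK.
have affE : aff_hull F = [set v | dotv u v = c].
  apply/seteqP; split=> v.
    move=> [n [p [k [Fp [k1 ->]]]]] /=; rewrite dotv_sum (eq_bigr (fun i => k i * c)).
      by rewrite -mulr_suml k1 mul1r.
    by move=> i _; rewrite dotvZ; have [_ ->] := (FP _).1 (Fp i).
  move=> /= uv; exists 3%N, (fun i => if i == 0 then a else if i == 1 then b else d), (fun i =>
    w v 0 i).
  split=> //; split=> //; apply: (mulIf (lt0r_neq0 c0)); rewrite mul1r -[RHS]uv [in RHS](wE v).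
  rewrite dotv_sum mulr_suml; apply: eq_bigr => i _; rewrite dotvZ.
  by have [_ ->] := (FP _).1 (Fv i).
have spanE : L `&` rspan (aff_hull F) = L.
  apply/seteqP; split=> v; first by case.
  move=> Lv; split=> //; exists 3%N, (fun i =>
    if i == 0 then a else if i == 1 then b else d), (fun i => w v 0 i).
  by split=> // i; rewrite affE /=; have [_ ->] := (FP _).1 (Fv i).
have [[La _] ua] := (fP a).1 af.
have zE : zspan (aff_hull F `&` L) = levelZ L u c by rewrite -(zspan_level Lsub La ua) affE.
rewrite /ID spanE zE; have [n] := index_levelZ Lsub Lfin fP af bf df det; exact: lat_indexP.
Qed.

(** The lists of the triangles are concatenated. They exhaust the set since the triangles cover [F],
    and are disjoint since each point projects into the relative interior of its triangle. *)
Lemma card_iint_set : has_card (iint_set tau F) ((ID tau F - 1) * IV_decomp tau D)%N.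
Proof.
have /choice[l lP] (t : V * V * V) : exists l : seq V, t \in D ->
  [/\ uniq l, size l = ((ID tau F - 1) * IV_tri tau t)%N,
    forall v, v \in l -> [/\ indec P v, dotv u v <> c &
      exists x y z, [/\ 0 < x, 0 < y, 0 < z & v = x *: t.1.1 + y *: t.1.2 + z *: t.2]]
  & forall v x y z, 0 <= x -> 0 <= y -> 0 <= z -> v = x *: t.1.1 + y *: t.1.2 + z *: t.2 ->
      indec P v -> dotv u v <> c -> v \in l].
  have [tD|_] := boolP (t \in D); last by exists [::].
  case: t tD => -[a b] d tD; have [af bf df det] := triangleP tD.
  have [n /lat_indexP hIV] := index_edges Lsub Lfin c0 fP af bf df det.
  have [k [h1 h2 h3 h4]] := indec_triangle_count Lsub c0 supp fP af bf df det (ID_index tD) hIV.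
  by exists k.
have height_pos v : P v -> 0 < dotv u v by move=> /supp; exact: lt_le_trans.
(* Radial projection to the plane of the face divides the coordinates by their sum. *)
have scaled t v x y z : t \in D -> P v -> v = x *: t.1.1 + y *: t.1.2 + z *: t.2 ->
    [/\ 0 < x + y + z, dotv u v = (x + y + z) * c &
     (c / dotv u v) *: v = (x / (x + y + z)) *: t.1.1 + (y / (x + y + z)) *: t.1.2 + (z / (x + y
       + z)) *: t.2].
  case: t => -[a b] d tD Pv /= vE; have [af bf df det] := triangleP tD.
  have e : dotv u v = (x + y + z) * c by rewrite vE (dotv_comb fP af bf df).
  have s0 : 0 < x + y + z by rewrite -(pmulr_lgt0 _ c0) -e height_pos.
  split=> //; rewrite e [in LHS]vE.
  by apply/rowP => i; rewrite !mxE; field; rewrite !gt_eqF.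
pose ll := flatten [seq l t | t <- D].
have llP v : v \in ll -> exists2 t, t \in D & v \in l t.
  by move=> /flattenP[_ /mapP[t tD ->] vt]; exists t.
have ull : uniq ll.
  apply: (@uniq_flatten_disjoint _ _ (0, 0, 0)); first by move=> t /lP[].
  move=> i j si sj ij v vi vj; case: hD => _ [_ Dd].
  have relint k : (k < size D)%N -> v \in l (nth (0, 0, 0) D k) ->
      tri_relint (nth (0, 0, 0) D k) ((c / dotv u v) *: v).
    move=> sk vk; have tD := mem_nth (0, 0, 0) sk;
      have [_ _ /(_ v vk)[iv uv [x [y [z [x0 y0 z0 vE]]]]] _] := lP _ tD.
    have [s0 e ->] := scaled _ _ _ _ _ tD iv.1 vE.
    case: (nth _ _ _) => -[a b] d /=;
      exists (x / (x + y + z)), (y / (x + y + z)), (z / (x + y + z)).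
    by rewrite !divr_gt0 //; do 3!split=> //; split=> //; rewrite -!mulrDl divff // gt_eqF.
  have : (tri_relint (nth (0, 0, 0) D i) `&` tri_relint (nth (0, 0,
    0) D j)) ((c / dotv u v) *: v).
    by split; apply: relint.
  by rewrite Dd.
(* [g] inverts [iotaM] on [L]; the value 0 elsewhere is a default. *)
have /choice[g gP] (v : V) : exists a : K, L v -> iotaM tau a = v.
  have [[a [_ ->]]|nL] := pselect (L v); last by exists 0.
  by exists a.
have llL v : v \in ll -> L v by move=> /llP[t tD vt]; have [_ _ /(_ v vt)[[[]]]] := lP _ tD.
exists [seq g v | v <- ll]; split.
  rewrite map_inj_in_uniq // => v w /llL Lv /llL Lw e.
  by rewrite -(gP _ Lv) -(gP _ Lw) e.
split.
  rewrite size_map size_flatten /shape -map_comp sumnE big_map /IV_decomp big_distrr /=.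
  rewrite big_seq [RHS]big_seq; apply: eq_bigr => t tD; by have [] := lP _ tD.
move=> a; split.
  move=> /mapP[v vl ->]; have Lv := llL v vl; have [t tD vt] := llP v vl.
  have [_ _ /(_ v vt)[iv uv [x [y [z [x0 y0 z0 vE]]]]] _] := lP _ tD.
  have [s0 e sE] := scaled _ _ _ _ _ tD iv.1 vE.
  split; first by apply/indecomposableP; rewrite gP.
  rewrite gP //; split; last by move=> /FP[_].
  exists (dotv u v / c), ((c / dotv u v) *: v); have h0 := height_pos v iv.1.
  split; first by rewrite divr_gt0.
  split; last by rewrite scalerA mulrA divfK ?gt_eqF // divff ?gt_eqF // scale1r.
  case: hD => _ [Dc _]; apply/Dc; exists t => //.
  case: t tD sE {vt vE} => -[p q] r tD /= sE; have [pf qf rf _] := triangleP tD.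
  apply/(triP _ c0 (fu pf) (fu qf) (fu rf)); split; last by rewrite dotvZ divfK // gt_eqF.
  rewrite sE; apply/cone_verts; exists (x / (x + y + z)), (y / (x + y + z)), (z / (x + y + z)).
  by rewrite !divr_ge0 ?ltW.
move=> [/indecomposableP ia [[k [x [k0 [Fx aE]]]] nF]].
apply/mapP; exists (iotaM tau a); last first.
  by apply: (@iotaM_inj _ _ tau); rewrite gP //; case: ia => -[].
case: hD => _ [Dc _]; have [t tD tx] := (Dc x).1 Fx.
apply/flattenP; exists (l t); first by apply/mapP; exists t.
have [_ _ _] := lP _ tD; case: t tD tx => -[p q] r tD tx; have [pf qf rf _] := triangleP tD.
have [/cone_verts[x1 [x2 [x3 [h1 h2 h3 xE]]]] ux] := (triP x c0 (fu pf) (fu qf) (fu rf)).1 tx.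
move=> /(_ (iotaM tau a) (k * x1) (k * x2) (k * x3)); apply; rewrite ?mulr_ge0 ?(ltW k0) //.
  by rewrite aE xE /= !scalerDr !scalerA.
(* At height [c] the vector would be a point of [f], hence of [F]. *)
move=> ua; apply: nF; apply/FP; split=> //; apply: cone_gen => /=; apply/fP; split=> //.
by case: ia.
Qed.

End Decomposition.
End Assembly.

(** Integer volume refers to a decomposition, so the count is proved for every decomposition, and
    one is shown to exist. Three distinct embeddings into [R] express that the cubic field is
    totally real. *)
Theorem theorem2p7 (R : realType) (K : fieldExtType rat)
    (hdeg : \dim {:K} = 3%N)
    (tau : 'I_3 -> {rmorphism K -> R})
    (htau : forall i j : 'I_3, i != j -> exists x : K, tau i x != tau j x)
    (F : set 'rV[R]_3) (hF : is_2face tau F) :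
  (exists D, int_decomposition tau F D) /\
  forall D, int_decomposition tau F D ->
    has_card (iint_set tau F) ((ID tau F - 1) * IV_decomp tau D)%N.
Proof.
case: hF => u [c [u0 [supp [FE [p0 [p1 [p2 [F0 [F1 [F2 rk]]]]]]]]]].
have Lfin := Lambda_finite hdeg htau; have Lnorm := Lambda_pos_norm hdeg htau.
have Lsmall := Lambda_small hdeg htau.
have [cl0 up0] : closure (sailhull tau) p0 /\ dotv u p0 = c.
  by move: F0; rewrite FE => -[[]].
have c0 := face_level_pos Lnorm Lsmall u0 supp cl0 up0.
have [f fP] := face_points Lfin Lnorm Lsmall u0 supp cl0 up0.
(* The face is the convex hull of [f], in cone form. One inclusion rests on the closedness of that
   polytope, the other on the fact that no point of the supporting plane is interior to the hull. *)
have FP x : F x <-> cone [set` f] x /\ dotv u x = c.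
  rewrite FE; split=> [[[clx _] ux]|[Cx ux]].
    split=> //; apply: cone_sub (face_cone Lfin Lnorm Lsmall u0 supp cl0 up0 clx ux).
    by move=> v /fP.
  split=> //; split; last exact: face_not_interior ux.
  apply: subset_closure; apply: (@conv_sub _ [set` f]); first by move=> v /= /fP[].
  by apply/(conv_coneP (u := u) (c := c)) => // v /= /fP[].
split; first exact: (exists_int_decomposition c0 fP FP F0 F1 F2).
move=> D hD; apply: (card_iint_set hdeg htau c0 _ fP FP hD) => p Pp.
exact/supp/conv_gen.
Qed.
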